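(* Let $b\ge3$, $D\subset\{0,\dots,b-1\}$ with $2\le|D|<b$, let $s=\gcd\{d-d':d,d'\in D\}$, and assume $s\mid d$ for all $d\in D$. List $\mathcal C_{b,D}$ increasingly as $k_1<k_2<\cdots$. Let $U,V$ be commuting unitary operators on a Hilbert space $\mathcal H$. Then for every $x\in\mathcal H$ the limit $\lim_{N\to\infty}\frac1N\sum_{n=1}^N U^{k_n}V^{s_b(k_n)}x$ exists in norm. Moreover, the limit for $x$ equals the limit for $Px$, where $P$ is the orthogonal projection onto the closed span of the joint eigenvectors $y$ with $Uy=e(\alpha)y$, $Vy=e(\beta)y$ for which there exist integers $a,r,t$ with $s\alpha\equiv\frac{a}{b-1}+\frac{r}{b^t}$ and $s\beta\equiv-\frac{a}{b-1}\pmod 1$; in particular the limit is $0$ if $x$ is orthogonal to all such eigenvectors.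
   Context: $\mathcal C_{b,D}=\{\sum_{j=0}^{k} d_j b^j : k\in\mathbb N_0,\ d_j\in D\}$; $s_b$ is the base-$b$ sum of digits; $e(x)=e^{2\pi ix}$. *)

(* Defs.v *)
(* mathcomp-analysis + real_closed complex numbers R[i]. *)
From HB Require Import structures.
From mathcomp Require Import all_boot all_order all_algebra.
From mathcomp Require Import all_classical all_reals all_analysis.
From mathcomp Require Import complex.
Set Implicit Arguments. Unset Strict Implicit. Unset Printing Implicit Defensive.
Import Order.TTheory GRing.Theory Num.Theory.
Import numFieldNormedType.Exports.
Local Open Scope ring_scope.
Local Open Scope classical_set_scope.

(* ---------- digits ---------- *)

(* C_{b,D} = { sum_{j=0}^k d_j b^j : k in N_0, d_j in D } *)
Definition digit_set (b : nat) (D : {set 'I_b}) : set nat :=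
  [set n | exists ds : seq 'I_b,
     [/\ (0 < size ds)%N, all (fun d => d \in D) ds &
         n = (\sum_(j < size ds) (nth 0%N (map val ds) j) * b ^ j)%N]].

(* base-b sum of digits s_b(n) (b >= 2): digit j is (n %/ b^j) %% b, and
   digits of index > n vanish since b^j > n. *)
Definition sumdigits (b n : nat) : nat :=
  (\sum_(j < n.+1) (n %/ b ^ j) %% b)%N.

(* s = gcd { d - d' : d, d' in D } *)
Definition digit_gcd (b : nat) (D : {set 'I_b}) : nat :=
  (\big[gcdn/0]_(d in D) \big[gcdn/0]_(d' in D) `|(d : int) - (d' : int)|)%N.

(* ---------- complex Hilbert spaces ---------- *)

(* e(x) = exp(2 pi i x) *)
Definition ee (R : realType) (x : R) : R[i] :=
  (cos (2 * pi * x) +i* sin (2 * pi * x))%C.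

(* ip is an inner product on the complex normed space H (linear in the first
   argument, conjugate symmetric) inducing its norm; together with
   completeness of H this makes H a complex Hilbert space. *)
Definition is_inner_product (R : realType) (H : completeNormedModType R[i])
    (ip : H -> H -> R[i]) : Prop :=
  [/\ (forall (a : R[i]) (x y z : H), ip (a *: x + y) z = a * ip x z + ip y z),
      (forall x y : H, ip y x = (ip x y)^*) &
      forall x : H, ip x x = `|x| ^+ 2].

(* unitary operator: linear, surjective, preserves the inner product *)
Definition unitary (R : realType) (H : completeNormedModType R[i])
    (ip : H -> H -> R[i]) (U : H -> H) : Prop :=
  [/\ (forall (a : R[i]) (x y : H), U (a *: x + y) = a *: U x + U y),
      (forall y : H, (exists x, U x = y)) &
     
      forall x y : H, ip (U x) (U y) = ip x y].

(* the closed linear span of a set of vectors *)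
Definition lin_span (R : realType) (H : completeNormedModType R[i]) (E : set H) : set H :=
  [set x | exists n (c : 'I_n -> R[i]) (y : 'I_n -> H),
     (forall i, E (y i)) /\ x = \sum_(i < n) c i *: y i].

Definition closed_span (R : realType) (H : completeNormedModType R[i]) (E : set H) : set H :=
  closure (lin_span E).

(* the ergodic averages (1/N) sum_{n=1}^N U^{k_n} V^{s_b(k_n)} x, where the
   enumeration is k_1 = k 0, k_2 = k 1, ... *)
Definition erg_avg (R : realType) (H : completeNormedModType R[i])
    (b : nat) (k : nat -> nat) (U V : H -> H) (x : H) (N : nat) : H :=
  (N%:R : R[i])^-1 *: \sum_(i < N) iter (k i) U (iter (sumdigits b (k i)) V x).

(* joint eigenvectors y != 0, U y = e(alpha) y, V y = e(beta) y, with
   s alpha = a/(b-1) + r/b^t and s beta = - a/(b-1) (mod 1), a r t integers *)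
Definition good_eigvec (R : realType) (H : completeNormedModType R[i])
    (b s : nat) (U V : H -> H) : set H :=
  [set y | y != 0 /\ exists alpha beta : R,
     [/\ U y = ee alpha *: y, V y = ee beta *: y &
       exists (a r t m1 m2 : int),
         s%:R * alpha = a%:~R / (b%:R - 1) + r%:~R / (b%:R ^ t) + m1%:~R /\
         s%:R * beta = - (a%:~R / (b%:R - 1)) + m2%:~R]].

(* Main.v *)
(** The numbers of [C_{b,D}] split into blocks [c + b^l q] with [c] running over all words of [l]
    digits, so the averages are governed by the products [A l] of the commuting contractions
    [T_j = |D|^-1 \sum_(d in D) (U^(b^j) V)^d].  Put [W_j = (U^(b^j) V)^s].  The vectors fixed by
    all late [W_j] decompose, by a finite Fourier transform, into the good joint eigenvectors, and
    on them [U^k V^(s_b k)] depends only on the low digits of [k] in [C_{b,D}].  It remains to see that [A n x -> 0] when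
    [x] is orthogonal to all those vectors; no spectral theorem is needed:

    - [|y|^2 - |T_j y|^2] controls [|W_j y - y|^2], so [\sum_j |W_j (A j x) - A j x|^2] converges;
    - as [W_(j+1) Q = W_j^b] with [Q = V^((b-1)s)], this kills the range of [Q - 1], which reduces
      the problem to [Q x = x];
    - then the product [M t n] of the means of [1, W_j, ..., W_j^(b-1)] over [t <= j < t + n] is an
      ergodic average of [W_t], hence [M t n x -> 0] as [n] grows, whereas
      [|A (t+n) x|^2 - |M t n (A (t+n) x)|^2] is at most a constant times the tail
      [|A t x|^2 - |A (t+n) x|^2]. *)
Require Import Defs.
From HB Require Import structures.
From mathcomp Require Import all_boot all_order all_algebra.
From mathcomp Require Import all_classical all_reals all_analysis.
From mathcomp Require Import complex ring lra.
Import Order.TTheory GRing.Theory Num.Theory.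
Import numFieldNormedType.Exports.
Set Implicit Arguments. Unset Strict Implicit. Unset Printing Implicit Defensive.
Local Open Scope ring_scope.
Local Open Scope classical_set_scope.

(** * Real norm and inner product *)

Section RealStructure.
Context {R : realType} {H : completeNormedModType R[i]}.
Implicit Types (x y z : H) (a : R[i]) (t : R).

(** The norm of [H] takes values in [R[i]]; its real part carries the same information in the
    totally ordered field [R], where estimates can be handled by [lra] and [nra]. *)
Definition nr (x : H) : R := complex.Re (`|x| : R[i]).

Lemma nrE x : `|x| = (nr x)%:C%C.
Proof. by rewrite /nr RRe_real // ger0_real. Qed.

Lemma nr_ge0 x : 0 <= nr x.
Proof. by have := normr_ge0 x; rewrite nrE lecR. Qed.

Lemma nr0 : nr 0 = 0.
Proof. by rewrite /nr normr0. Qed.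

Lemma nr_eq0 x : nr x = 0 -> x = 0.
Proof. by move=> h; apply/eqP; rewrite -normr_eq0 nrE h. Qed.

Lemma nrN x : nr (- x) = nr x.
Proof. by rewrite /nr normrN. Qed.

Lemma nrC x y : nr (x - y) = nr (y - x).
Proof. by rewrite -nrN opprB. Qed.

Lemma nrD x y : nr (x + y) <= nr x + nr y.
Proof. by rewrite -lecR rmorphD /= -!nrE ler_normD. Qed.

Lemma nrB x y : nr (x - y) <= nr x + nr y.
Proof. by rewrite -(nrN y) nrD. Qed.

Lemma nr_sum (I : Type) (r : seq I) (P : pred I) (F : I -> H) :
  nr (\sum_(i <- r | P i) F i) <= \sum_(i <- r | P i) nr (F i).
Proof.
elim/big_rec2: _ => [|i y1 y2 _ h]; first by rewrite nr0.
by apply: le_trans (nrD _ _) _; rewrite lerD2l.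
Qed.

Lemma nrZ a x : nr (a *: x) = complex.Re `|a| * nr x.
Proof.
rewrite /nr normrZ [in LHS]nrE; case: `|a| => u v /=.
by rewrite mulr0 subr0.
Qed.

Lemma nrZr t x : nr (t%:C%C *: x) = `|t| * nr x.
Proof. by rewrite nrZ normc_def /= expr0n addr0 sqrtr_sqr. Qed.

Lemma natrC n : (n%:R : R[i]) = (n%:R : R)%:C%C.
Proof. by rewrite rmorph_nat. Qed.

Lemma invnC n : (n%:R^-1 : R[i]) = (n%:R^-1 : R)%:C%C.
Proof. by rewrite natrC fmorphV. Qed.

Lemma nrZV n x : nr ((n%:R : R[i])^-1 *: x) = n%:R^-1 * nr x.
Proof. by rewrite invnC nrZr ger0_norm // invr_ge0. Qed.

Definition converges (u : nat -> H) (l : H) :=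
  forall eps : R, 0 < eps -> exists N, forall n, (N <= n)%N -> nr (u n - l) < eps.

Lemma convergesP (u : nat -> H) (l : H) : converges u l <-> u @ \oo --> l.
Proof.
split=> [h|/cvgrPdist_lt h eps e0].
  apply/cvgrPdist_lt => eps e0.
  have er : eps = (complex.Re eps)%:C%C by rewrite RRe_real // gtr0_real.
  rewrite er ltcR in e0; have [N hN] := h _ e0.
  exists N => // n /= Nn; rewrite er nrE ltcR nrC; exact: hN.
have e1 : 0 < eps%:C%C by rewrite ltcR.
have [N _ hN] := h _ e1.
exists N => n Nn; have /= := hN n Nn.
by rewrite nrE ltcR nrC.
Qed.

Lemma converges_Cauchy (u : nat -> H) :
  (forall eps : R, 0 < eps -> exists N, forall n m, (N <= n)%N -> (N <= m)%N ->
     nr (u n - u m) < eps) ->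
  exists l, converges u l.
Proof.
move=> h; have /cauchy_cvgP uc : cauchy (u @ \oo).
  apply: cauchy_exP => eps e0.
  have er : eps = (complex.Re eps)%:C%C by rewrite RRe_real // gtr0_real.
  rewrite er ltcR in e0; have [N hN] := h _ e0.
  exists (u N); exists N => // n /= Nn.
  by rewrite -ball_normE /= er nrE ltcR; apply: hN.
by exists (lim (u @ \oo)); apply/convergesP.
Qed.

(** Membership in the norm closure of [S], in the form in which approximants are used below. *)
Definition adherent (S : H -> Prop) x :=
  forall eps : R, 0 < eps -> exists2 z, S z & nr (x - z) < eps.

Lemma convergesD (u v : nat -> H) k l :
  converges u k -> converges v l -> converges (fun n => u n + v n) (k + l).
Proof. by rewrite !convergesP; exact: cvgD. Qed.

Definition lin (f : H -> H) := forall a x y, f (a *: x + y) = a *: f x + f y.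

Section Lin.
Context (f : H -> H) (fl : lin f).
Lemma linD x y : f (x + y) = f x + f y.
Proof. by have := fl 1 x y; rewrite !scale1r. Qed.
Lemma lin0 : f 0 = 0.
Proof. by have := linD 0 0; rewrite addr0 -{1}[f 0]addr0 => /addrI. Qed.
Lemma linZ a x : f (a *: x) = a *: f x.
Proof. by have := fl a x 0; rewrite !addr0 lin0 addr0. Qed.
Lemma linN x : f (- x) = - f x.
Proof. by rewrite -scaleN1r linZ scaleN1r. Qed.
Lemma linB x y : f (x - y) = f x - f y.
Proof. by rewrite linD linN. Qed.
Lemma linS (I : Type) (r : seq I) (P : pred I) (F : I -> H) :
  f (\sum_(i <- r | P i) F i) = \sum_(i <- r | P i) f (F i).
Proof. by elim/big_rec2: _ => [|i y1 y2 _ <-]; rewrite ?lin0 ?linD. Qed.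
Lemma lin_iter n : lin (iter n f).
Proof. by elim: n => [|n IH] a x y //=; rewrite IH fl. Qed.
End Lin.

Lemma iter_comm (f g : H -> H) n x :
  (forall x, f (g x) = g (f x)) -> iter n f (g x) = g (iter n f x).
Proof. by move=> h; elim: n => //= n ->. Qed.

End RealStructure.

(** * Real part of the inner product, Cauchy-Schwarz and orthogonal projection *)

Section InnerProduct.
Context {R : realType} {H : completeNormedModType R[i]}.
Context (ip : H -> H -> R[i]) (ipP : is_inner_product ip).
Implicit Types (x y z : H) (a : R[i]) (t : R).

Definition rip x y : R := complex.Re (ip x y).

Lemma ripDl x y z : rip (x + y) z = rip x z + rip y z.
Proof.
by case: ipP => h _ _; have := h 1 x y z; rewrite scale1r mul1r /rip => ->; rewrite raddfD.
Qed.
Lemma ripC x y : rip x y = rip y x.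
Proof.
case: ipP => _ h _; rewrite /rip (h x y); set w := ip x y.
by have : (complex.Re w^*)%:C%C = (complex.Re w)%:C%C; [rewrite !complexRe Re_conj | case].
Qed.

Lemma ripxx x : rip x x = nr x ^+ 2.
Proof. by case: ipP => _ _ h; rewrite /rip h nrE -rmorphXn. Qed.

Lemma ripDr x y z : rip z (x + y) = rip z x + rip z y.
Proof. by rewrite ripC ripDl !(ripC z). Qed.

Lemma rip0l z : rip 0 z = 0.
Proof. by apply: (addrI (rip 0 z)); rewrite -ripDl !addr0. Qed.

Lemma ripNl x z : rip (- x) z = - rip x z.
Proof. by apply/eqP; rewrite -addr_eq0 -ripDl addNr rip0l. Qed.

Lemma ripBl x y z : rip (x - y) z = rip x z - rip y z.
Proof. by rewrite ripDl ripNl. Qed.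

Lemma ripBr x y z : rip z (x - y) = rip z x - rip z y.
Proof. by rewrite ripC ripBl !(ripC z). Qed.

Lemma ripZl t x z : rip (t%:C%C *: x) z = t * rip x z.
Proof.
case: ipP => h _ _; have /= e0 := rip0l z.
rewrite -[_ *: x]addr0 ripDl e0 addr0 /rip.
have -> : ip (t%:C%C *: x) z = t%:C%C * ip x z.
  have h0 : ip 0 z = 0.
    by have := h 1 0 0 z; rewrite scaler0 add0r mul1r => /eqP; rewrite -subr_eq subrr => /eqP.
  by rewrite -[_ *: x]addr0 h h0 addr0.
by case: (ip x z) => u v /=; rewrite mul0r subr0.
Qed.

Lemma nr_sqB x y : nr (x - y) ^+ 2 = nr x ^+ 2 - 2 * rip x y + nr y ^+ 2.
Proof. by rewrite -!ripxx !ripBl !ripBr (ripC y x); ring. Qed.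

Lemma nr_sqD x y : nr (x + y) ^+ 2 = nr x ^+ 2 + 2 * rip x y + nr y ^+ 2.
Proof. by rewrite -!ripxx !ripDl !ripDr (ripC y x); ring. Qed.

Lemma rip_CS x y : `|rip x y| <= nr x * nr y.
Proof.
have [y0|y0] := eqVneq (nr y) 0.
  by rewrite (nr_eq0 y0) ripC rip0l normr0 mulr_ge0 ?nr_ge0.
have yp : 0 < nr y by rewrite lt_def y0 nr_ge0.
(* Expanding this square leaves [|y|^2] times the Cauchy-Schwarz gap. *)
have := sqr_ge0 (nr ((nr y ^+ 2)%:C%C *: x - (rip x y)%:C%C *: y)).
rewrite nr_sqB ripZl ripC ripZl !nrZr !exprMn !real_normK ?num_real // (ripC y).
move=> h; rewrite -ler_sqr ?nnegrE ?normr_ge0 ?mulr_ge0 ?nr_ge0 //.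
rewrite real_normK ?num_real // exprMn.
have y2 : 0 < nr y ^+ 2 by rewrite exprn_gt0.
rewrite -subr_ge0 -(pmulr_rge0 _ y2); apply: le_trans h _.
by rewrite le_eqVlt; apply/orP; left; apply/eqP; ring.
Qed.

Lemma adherent_orth (S : H -> Prop) x e :
  (forall z, S z -> rip z e = 0) -> adherent S x -> rip x e = 0.
Proof.
move=> h a; apply/eqP; rewrite -normr_le0; apply/ler_addgt0Pr => eps e0.
have e1 : 0 < nr e + 1 by rewrite ltr_wpDl ?nr_ge0.
(* The [+ 1] keeps the denominator positive when [e = 0]. *)
have [z Sz hz] := a (eps / (nr e + 1)) (divr_gt0 e0 e1).
rewrite add0r -[rip x e]subr0 -(h z Sz) -ripBl.
apply: le_trans (rip_CS _ _) _.
apply: le_trans (_ : eps / (nr e + 1) * (nr e + 1) <= _); last by rewrite divfK ?gt_eqF.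
by apply: ler_pM; rewrite ?nr_ge0 ?lerDl //; apply: ltW.
Qed.

Lemma lin_nr (f : H -> H) : (forall x y, rip (f x) (f y) = rip x y) -> forall x, nr (f x) = nr x.
Proof.
move=> h x; apply/eqP; rewrite -(@eqrXn2 _ 2) ?nr_ge0 //.
by rewrite -!ripxx h.
Qed.

(** A minimising sequence for the distance from [x] to [S] is Cauchy by the parallelogram law. [S]
    is a real subspace, possibly not closed, so the foot [p] is only a limit of points of [S]. *)
Lemma projection (S : H -> Prop) x :
  S 0 -> (forall u v, S u -> S v -> S (u + v)) -> (forall t u, S u -> S (t%:C%C *: u)) ->
  exists2 p, adherent S p & forall z, S z -> rip (x - p) z = 0.
Proof.
move=> S0 SD SZ.
pose E : set R := [set nr (x - z) ^+ 2 | z in S].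
have Einf : has_inf E.
  split; first by exists (nr (x - 0) ^+ 2), 0.
  by exists 0 => _ [z _ <-]; exact: sqr_ge0.
pose d := inf E.
have dle z : S z -> d <= nr (x - z) ^+ 2.
  by move=> Sz; apply: ge_inf; [exact: Einf.2 | exists z].
have /choice[u hu] (n : nat) : exists z, S z /\ nr (x - z) ^+ 2 < d + n.+1%:R^-1.
  have [|_ [z Sz <-] h] := @inf_adherent _ E n.+1%:R^-1 _ Einf; first by rewrite invr_gt0.
  by exists z.
have cau n m : nr (u n - u m) ^+ 2 <= 2 * n.+1%:R^-1 + 2 * m.+1%:R^-1.
  have [[Sn hn] [Sm hm]] := (hu n, hu m).
  (* The midpoint of [u n] and [u m] lies in [S]; its distance to [x] bounds the cross term from
     below. *)
  have h1 := dle ((2^-1 : R)%:C%C *: (u n + u m)) (SZ _ _ (SD _ _ Sn Sm)).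
  have hx : x - (2^-1 : R)%:C%C *: (u n + u m)
    = (2^-1 : R)%:C%C *: ((x - u n) + (x - u m)).
    rewrite addrACA -opprD scalerBr; congr (_ - _).
    have -> : x + x = (2 : R)%:C%C *: x by rewrite -mulr2n -[in LHS]scaler_nat natrC.
    by rewrite scalerA -rmorphM /= mulVf ?scale1r // pnatr_eq0.
  rewrite hx nrZr exprMn nr_sqD real_normK ?num_real // in h1.
  have -> : u n - u m = (x - u m) - (x - u n).
    by rewrite opprB [RHS]addrC addrA subrK.
  rewrite nr_sqB (ripC (x - u m)).
  have : nr (x - u n) ^+ 2 + 2 * rip (x - u n) (x - u m) + nr (x - u m) ^+ 2 >= 4 * d by nra.
  move: h1 hn hm; set a := nr _; set bb := nr _; set cc := rip _ _ ; set e1 := n.+1%:R^-1; set e2 := m.+1%:R^-1 => h1 hn hm h4; lra.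
have hinv (eps : R) : 0 < eps -> exists N, forall n, (N <= n)%N -> n.+1%:R^-1 < eps.
  move=> e0; have [N _ hN] := near_infty_natSinv_lt (PosNum e0).
  by exists N => n Nn; exact: hN.
have [|p hp] := @converges_Cauchy _ _ u.
  move=> eps e0; have [N hN] := hinv (eps ^+ 2 / 4) (divr_gt0 (exprn_gt0 2 e0) (ltr0Sn _ 3)).
  exists N => n m Nn Nm; rewrite -(@ltr_pXn2r _ 2) ?nnegrE ?nr_ge0 ?ltW //.
  move: (cau n m) (hN n Nn) (hN m Nm).
  by set e1 := n.+1%:R^-1; set e2 := m.+1%:R^-1; lra.
exists p => [eps e0|z Sz].
  have [N hN] := hp _ e0; exists (u N); first by case: (hu N).
  by rewrite nrC hN.
(* First variation along [z]. As [p] may lie outside [S], minimality is used at [u n + t z] and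
   passed to the limit with [eps] of room. *)
have key t : 0 <= - (2 * t * rip (x - p) z) + t ^+ 2 * nr z ^+ 2.
  apply/ler_addgt0Pr => eps e0; have [K Kp Kd] : exists2 K, 0 < K & K = 2 * `|t| * nr z + 1.
    by exists (2 * `|t| * nr z + 1); rewrite // ltr_wpDl // !mulr_ge0 ?nr_ge0.
  have [N1 h1] := hinv (eps / 2) (divr_gt0 e0 (ltr0Sn _ 1)).
  have [N2 h2] := hp (eps / 2 / K) (divr_gt0 (divr_gt0 e0 (ltr0Sn _ 1)) Kp).
  pose n := maxn N1 N2; have [Sn hn] := hu n.
  have := dle _ (SD _ _ Sn (SZ t _ Sz)); rewrite opprD addrA nr_sqB ripC ripZl nrZr exprMn.
  rewrite real_normK ?num_real // ripC => h3.
  have h4 : `|2 * t * rip (u n - p) z| <= eps / 2.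
    rewrite normrM; apply: le_trans (_ : `|2 * t| * (eps / 2 / K * nr z) <= _).
      rewrite ler_wpM2l //; apply: le_trans (rip_CS _ _) _.
      by rewrite ler_wpM2r ?nr_ge0 // ltW // h2 // leq_maxr.
    rewrite normrM ger0_norm //.
    have -> : 2 * `|t| * (eps / 2 / K * nr z) = eps / 2 * ((2 * `|t| * nr z) / K) by ring.
    rewrite ler_piMr ?divr_ge0 ?ler_pdivrMr ?mul1r ?lerDl //; last by rewrite Kd lerDl.
    exact: ltW.
  have h5 : rip (x - u n) z = rip (x - p) z - rip (u n - p) z.
    by rewrite -ripBl opprB addrA subrK.
  have h6 := h1 n (leq_maxl _ _).
  move: h4; rewrite ler_norml => /andP[h4 h4']; rewrite h5 in h3.
  move: h3 hn h6 h4 h4'; set e1 := n.+1%:R^-1; set q := rip _ _; set q' := rip _ _.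
  by lra.
(* This [t] is defined even for [z = 0]; after clearing denominators [key] reads
   [- q^2 (|z|^2 + 2) >= 0]. *)
set q := rip (x - p) z; have := key (q / (nr z ^+ 2 + 1)).
have zp : 0 < nr z ^+ 2 + 1 by rewrite ltr_wpDl ?sqr_ge0.
rewrite -/q => h; apply/eqP; rewrite -sqrf_eq0 eq_le sqr_ge0 andbT.
have : 0 <= (- (2 * (q / (nr z ^+ 2 + 1)) * q) + (q / (nr z ^+ 2 + 1)) ^+ 2 * nr z ^+ 2)
   * (nr z ^+ 2 + 1) ^+ 2 by rewrite mulr_ge0 ?sqr_ge0.
have -> : (- (2 * (q / (nr z ^+ 2 + 1)) * q) + (q / (nr z ^+ 2 + 1)) ^+ 2 * nr z ^+ 2)
   * (nr z ^+ 2 + 1) ^+ 2 = - (q ^+ 2 * (nr z ^+ 2 + 2)).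
  by field; rewrite gt_eqF.
rewrite oppr_ge0 pmulr_lle0 //.
by rewrite ltr_wpDl ?sqr_ge0.
Qed.

End InnerProduct.

(** * Means of powers of an isometry *)

Section Isometries.
Context {R : realType} {H : completeNormedModType R[i]}.
Context (ip : H -> H -> R[i]) (ipP : is_inner_product ip).
Local Notation rip := (rip ip).
Implicit Types (x y z : H) (f g : H -> H) (r : seq nat).

Definition lin_isometry f := lin f /\ forall x y, rip (f x) (f y) = rip x y.

Lemma isometry_nr f x : lin_isometry f -> nr (f x) = nr x.
Proof. by case=> _ h; exact: (lin_nr ipP h). Qed.

Lemma isometry_comp f g : lin_isometry f -> lin_isometry g -> lin_isometry (f \o g).
Proof.
move=> [fl fi] [gl gi]; split=> [a x y|x y] /=; first by rewrite gl fl.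
by rewrite fi gi.
Qed.

Lemma isometry_iter n f : lin_isometry f -> lin_isometry (iter n f).
Proof.
move=> fi; elim: n => [|n IH]; first by split.
exact: (isometry_comp fi IH).
Qed.

Lemma nr_iter_sub n f x : lin_isometry f -> nr (iter n f x - x) <= n%:R * nr (f x - x).
Proof.
move=> fi; elim: n => [|n IH] /=; first by rewrite subrr nr0 mul0r.
have -> : f (iter n f x) - x = f (iter n f x - x) + (f x - x).
  by rewrite (linB fi.1) addrA subrK.
apply: le_trans (nrD _ _) _; rewrite (isometry_nr _ fi) -natr1 mulrDl mul1r.
by rewrite lerD2r.
Qed.

(** Taking [r = digits D] gives the operators [T_j]; taking [r = iota 0 b] gives the means of the
    first [b] powers. *)
Definition mean r f x : H := ((size r)%:R : R[i])^-1 *: \sum_(d <- r) iter d f x.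

Lemma mean_lin r f : lin f -> lin (mean r f).
Proof.
move=> fl a x y; rewrite /mean scalerA mulrC -scalerA -scalerDr; congr (_ *: _).
by rewrite scaler_sumr -big_split /=; apply: eq_bigr => d _; rewrite lin_iter.
Qed.

Lemma mean_comm r f g x :
  lin g -> (forall y, f (g y) = g (f y)) -> mean r f (g x) = g (mean r f x).
Proof.
move=> gl fg; rewrite /mean (linZ gl) (linS gl); congr (_ *: _).
by apply: eq_bigr => d _; rewrite iter_comm.
Qed.

Lemma sum_const_seq (V : nmodType) (I : Type) (s : seq I) (c : V) :
  \sum_(i <- s) c = c *+ size s.
Proof. by rewrite big_const_seq count_predT iter_addr_0. Qed.

Lemma rip_suml (I : Type) (s : seq I) (F : I -> H) z :
  rip (\sum_(i <- s) F i) z = \sum_(i <- s) rip (F i) z.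
Proof. by elim/big_rec2: _ => [|i y1 y2 _ <-]; rewrite ?rip0l ?ripDl. Qed.

(** A variance identity: all [|f^d x|] equal [|x|], and the inner products in the expanded squares
    add up to the squared norm of the sum. *)
Lemma mean_defect r f x : lin_isometry f -> (0 < size r)%N ->
  nr x ^+ 2 - nr (mean r f x) ^+ 2 =
  (2 * (size r)%:R ^+ 2)^-1 *
    \sum_(d <- r) \sum_(d' <- r) nr (iter d f x - iter d' f x) ^+ 2.
Proof.
move=> fi r0; set m := size r.
have m0 : m%:R != 0 :> R by rewrite pnatr_eq0 -lt0n.
set s := \sum_(d <- r) iter d f x.
have -> : \sum_(d <- r) \sum_(d' <- r) nr (iter d f x - iter d' f x) ^+ 2
  = 2 * m%:R ^+ 2 * nr x ^+ 2 - 2 * nr s ^+ 2.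
  rewrite -(ripxx ipP s) {1}/s rip_suml.
  transitivity (\sum_(d <- r) (2 * m%:R * nr x ^+ 2 - 2 * rip (iter d f x) s)).
    apply: eq_bigr => d _; rewrite (ripC ipP) rip_suml.
    transitivity (\sum_(d' <- r) (2 * nr x ^+ 2 - 2 * rip (iter d' f x) (iter d f x))).
      apply: eq_bigr => d' _; rewrite (nr_sqB ipP) (ripC ipP).
      by rewrite !(isometry_nr _ (isometry_iter _ fi)); ring.
    rewrite sumrB sum_const_seq -mulr_sumr -mulr_natl -/m; congr (_ - _); ring.
  rewrite sumrB sum_const_seq -mulr_sumr -mulr_natl -/m; congr (_ - _); ring.
by rewrite /mean nrZV -/m -/s exprMn; field.
Qed.

Lemma ler_sum_mem (I : eqType) (s : seq I) (F : I -> R) i :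
  i \in s -> (forall j, 0 <= F j) -> F i <= \sum_(j <- s) F j.
Proof. by move=> si F0; rewrite (big_rem i) //= lerDl sumr_ge0. Qed.

Lemma mean_contract r f x : lin_isometry f -> (0 < size r)%N -> nr (mean r f x) <= nr x.
Proof.
move=> fi r0; rewrite -ler_sqr ?nnegrE ?nr_ge0 // -subr_ge0 mean_defect //.
rewrite mulr_ge0 ?invr_ge0 ?mulr_ge0 ?sqr_ge0 //.
by do 2 (apply: sumr_ge0 => ? _); exact: sqr_ge0.
Qed.

(** A single term of the double sum in [mean_defect], all of whose terms are nonnegative. *)
Lemma mean_defect_ge r f x d d' : lin_isometry f -> d \in r -> d' \in r ->
  nr (iter d f x - iter d' f x) ^+ 2 <=
  2 * (size r)%:R ^+ 2 * (nr x ^+ 2 - nr (mean r f x) ^+ 2).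
Proof.
move=> fi dr d'r; have r0 : (0 < size r)%N by case: (r) dr.
have m0 : (size r)%:R != 0 :> R by rewrite pnatr_eq0 -lt0n.
have q0 : 2 * (size r)%:R ^+ 2 != 0 :> R by rewrite mulf_neq0 ?expf_neq0 // pnatr_eq0.
rewrite mean_defect // mulrA mulfV // mul1r.
pose F i := \sum_(j <- r) nr (iter i f x - iter j f x) ^+ 2.
apply: le_trans (_ : F d <= _).
  by apply: (@ler_sum_mem _ _ (fun j => nr (iter d f x - iter j f x) ^+ 2)) => // j; rewrite sqr_ge0.
by apply: (@ler_sum_mem _ _ F) => // j; apply: sumr_ge0 => ? _; rewrite sqr_ge0.
Qed.

(** Conversely, each difference in [mean_defect] has norm at most [2 n |f x - x|]. *)
Lemma mean_defect_le n f x : lin_isometry f -> (0 < n)%N ->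
  nr x ^+ 2 - nr (mean (iota 0 n) f x) ^+ 2 <= 2 * n%:R ^+ 2 * nr (f x - x) ^+ 2.
Proof.
move=> fi n0; rewrite mean_defect ?size_iota //.
have m0 : n%:R != 0 :> R by rewrite pnatr_eq0 -lt0n.
have m1 : 0 < 2 * n%:R ^+ 2 :> R by rewrite mulr_gt0 // exprn_gt0 // ltr0n.
rewrite mulrC ler_pdivrMr //.
set w := nr (f x - x); have w0 : 0 <= w := nr_ge0 _.
apply: le_trans (_ : \sum_(d <- iota 0 n) \sum_(d' <- iota 0 n) (2 * n%:R * w) ^+ 2 <= _).
  rewrite big_seq [leRHS]big_seq; apply: ler_sum => d; rewrite mem_iota /= add0n => dn.
  rewrite big_seq [leRHS]big_seq; apply: ler_sum => d'; rewrite mem_iota /= add0n => d'n.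
  rewrite ler_sqr ?nnegrE ?nr_ge0 ?mulr_ge0 //.
  have -> : iter d f x - iter d' f x = (iter d f x - x) - (iter d' f x - x).
    by rewrite opprB addrA subrK.
  apply: le_trans (nrB _ _) _.
  have h k : (k < n)%N -> nr (iter k f x - x) <= n%:R * w.
    move=> kn; apply: le_trans (nr_iter_sub _ _ fi) _.
    by rewrite ler_wpM2r // ler_nat ltnW.
  by have := h _ dn; have := h _ d'n; lra.
rewrite !sum_const_seq size_iota -[_ ^+ 2 *+ n]mulr_natl -[(_ * _) *+ n]mulr_natl.
by rewrite le_eqVlt; apply/orP; left; apply/eqP; ring.
Qed.

(** By Bezout the gcd is the difference of a multiple of [m] and a multiple of [n]. *)
Lemma gcd_close (P : nat -> Prop) (m n : nat) :
  (forall i j, P i -> P (j * i)%N) -> (forall i j, P i -> P (j + i)%N -> P j) ->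
  P m -> P n -> P (gcdn m n).
Proof.
move=> PM PB Pm Pn; have [->|m0] := posnP m; first by rewrite gcd0n.
have [u v e _] := egcdnP n m0.
apply: (PB (v * n)%N); first exact: PM.
by rewrite addnC -e; exact: PM.
Qed.

Definition digits b (D : {set 'I_b}) : seq nat := [seq val d | d <- enum D].

Lemma mem_digits b (D : {set 'I_b}) (d : 'I_b) : d \in D -> (d : nat) \in digits D.
Proof. by move=> dD; apply: map_f; rewrite mem_enum. Qed.

(* The constant is uniform in f and x; it comes from a Bezout relation between the digit
   differences. *)
Lemma digit_gcd_close b (D : {set 'I_b}) : exists2 c : R, 0 <= c &
  forall f x (delta : R), lin_isometry f ->
    (forall d d', d \in digits D -> d' \in digits D ->
       nr (iter d f x - iter d' f x) <= delta) ->
    0 <= delta -> nr (iter (digit_gcd D) f x - x) <= c * delta.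
Proof.
pose P n := exists2 c : R, 0 <= c & forall f x (delta : R), lin_isometry f ->
    (forall d d', d \in digits D -> d' \in digits D ->
       nr (iter d f x - iter d' f x) <= delta) ->
    0 <= delta -> nr (iter n f x - x) <= c * delta.
have P0 : P 0%N by exists 0 => // f x delta _ _ _; rewrite subrr nr0 mul0r.
have PM i j : P i -> P (j * i)%N.
  case=> c c0 h; exists (j%:R * c) => [|f x delta fi h1 d0]; first by rewrite mulr_ge0.
  rewrite mulnC (_ : iter (i * j) f x = iter j (iter i f) x); last first.
    by elim: j => [|j IH]; rewrite ?muln0 //= mulnS iterD IH.
  apply: le_trans (nr_iter_sub _ _ (isometry_iter _ fi)) _.
  by rewrite -mulrA ler_wpM2l // h.
have PB i j : P i -> P (j + i)%N -> P j.
  case=> c c0 h [c' c'0 h']; exists (c + c') => [|f x delta fi h1 d0]; first exact: addr_ge0.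
  have fij := isometry_iter i fi.
  rewrite -(isometry_nr _ fij) (linB fij.1) -iterD addnC.
  have -> : iter (j + i) f x - iter i f x = (iter (j + i) f x - x) - (iter i f x - x).
    by rewrite opprB addrA subrK.
  apply: le_trans (nrB _ _) _; rewrite mulrDl addrC.
  by apply: lerD; [exact: h | exact: h'].
have Pgcd m n : P m -> P n -> P (gcdn m n) by exact: gcd_close.
rewrite -/(P (digit_gcd D)) /digit_gcd.
elim/big_ind: _ => // d dD; elim/big_ind: _ => // d' d'D.
exists 1 => // f x delta fi h _; rewrite mul1r.
wlog le : d d' dD d'D / (d <= d')%N.
  move=> hw; have [|] := leqP d d'; first exact: hw.
  by move=> /ltnW /(hw d' d d'D dD); rewrite distnC.
rewrite distnC distnEl //.
have fdi := isometry_iter d fi.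
(* The isometry [f^d] carries [f^(d' - d) x - x] to [f^d' x - f^d x]. *)
rewrite -(isometry_nr _ fdi) (linB fdi.1) -iterD subnKC //.
by apply: h; exact: mem_digits.
Qed.

(** [mean_defect_ge] bounds every [f^d x - f^d' x] by the square root of the defect, and
    [digit_gcd_close] carries this bound to the exponent [digit_gcd D]. *)
Lemma digit_gcd_defect b (D : {set 'I_b}) : exists2 C : R, 0 <= C &
  forall f x, lin_isometry f ->
    nr (iter (digit_gcd D) f x - x) ^+ 2 <= C * (nr x ^+ 2 - nr (mean (digits D) f x) ^+ 2).
Proof.
have [c c0 h] := digit_gcd_close D.
exists (c ^+ 2 * (2 * (size (digits D))%:R ^+ 2)) => [|f x fi].
  by rewrite !mulr_ge0 ?sqr_ge0.
have [m0|m0] := posnP (size (digits D)).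
  (* Without digits the gcd is [0] and both sides vanish. *)
  have -> : digit_gcd D = 0%N.
    rewrite /digit_gcd big1 // => d /mem_digits.
    by move/size0nil: m0 => ->.
  by rewrite subrr nr0 expr0n /= m0 expr0n /= !mulr0 mul0r.
set e := nr x ^+ 2 - _; have e0 : 0 <= e.
  by rewrite subr_ge0 ler_sqr ?nnegrE ?nr_ge0 // mean_contract.
set q := 2 * _; have q0 : 0 <= q * e by rewrite !mulr_ge0 ?sqr_ge0.
have h2 : nr (iter (digit_gcd D) f x - x) <= c * Num.sqrt (q * e).
  apply: h; rewrite ?sqrtr_ge0 // => d d' dD d'D; rewrite -ler_sqr ?nnegrE ?nr_ge0 ?sqrtr_ge0 // sqr_sqrtr //.
  exact: mean_defect_ge.
rewrite -mulrA -(sqr_sqrtr q0) -exprMn ler_sqr ?nnegrE ?nr_ge0 // mulr_ge0 ?sqrtr_ge0 //.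
Qed.

End Isometries.

(** * Decay of the digit products *)

Section Dynamics.
Context {R : realType} {H : completeNormedModType R[i]}.
Context (ip : H -> H -> R[i]) (ipP : is_inner_product ip).
Context (U V : H -> H) (Ui : lin_isometry ip U) (Vi : lin_isometry ip V).
Context (UV : forall x, U (V x) = V (U x)).
Context (b : nat) (b1 : (1 < b)%N) (D : {set 'I_b}) (D0 : (0 < size (digits D))%N).
Local Notation rip := (rip ip).
Local Notation s := (digit_gcd D).
Let b0 : (0 < b)%N := ltnW b1.
Implicit Types (x y z u : H) (f g : H -> H).

Definition mono p q x := iter p U (iter q V x).

Lemma isometry_mono p q : lin_isometry ip (mono p q).
Proof. exact: isometry_comp (isometry_iter p Ui) (isometry_iter q Vi). Qed.

Lemma mono_comp p q p' q' x : mono p q (mono p' q' x) = mono (p + p') (q + q') x.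
Proof.
rewrite /mono !iterD; congr (iter _ _ _); rewrite iter_comm // => y.
by rewrite -iter_comm // => w; rewrite UV.
Qed.

Lemma iter_mono n p q x : iter n (mono p q) x = mono (n * p) (n * q) x.
Proof. by elim: n => //= n ->; rewrite mono_comp. Qed.

(* The bicommutant of {U, V}: any two of its members commute. *)
Definition bicommutant f := lin f /\
  forall g, lin g -> (forall x, g (U x) = U (g x)) -> (forall x, g (V x) = V (g x)) ->
  forall x, f (g x) = g (f x).

Lemma bicommutant_comm f g : bicommutant f -> bicommutant g -> forall x, f (g x) = g (f x).
Proof.
move=> [_ fc] [gl gc]; apply: fc => // x; apply: gc => //; first exact: Ui.1.
exact: Vi.1.
Qed.

Lemma bicommutant_comp f g : bicommutant f -> bicommutant g -> bicommutant (f \o g).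
Proof.
move=> [fl fc] [gl gc]; split=> [a x y|h hl hU hV x] /=; first by rewrite gl fl.
by rewrite gc // fc.
Qed.

Lemma bicommutant_id : bicommutant id.
Proof. by split. Qed.

Lemma bicommutant_iter n f : bicommutant f -> bicommutant (iter n f).
Proof.
by move=> fb; elim: n => [|n IH]; [exact: bicommutant_id | exact: (bicommutant_comp fb IH)].
Qed.

Lemma bicommutant_mono p q : bicommutant (mono p q).
Proof.
by apply: bicommutant_comp; apply: bicommutant_iter; split=> [|g _ gU gV x];
  rewrite ?gU ?gV //; [exact: Ui.1 | exact: Vi.1].
Qed.

Lemma bicommutant_mean r f : bicommutant f -> bicommutant (mean r f).
Proof.
move=> [fl fc]; split=> [|g gl gU gV x]; first exact: mean_lin.
by apply: mean_comm => // y; exact: fc.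
Qed.

(** One unit of the digit at position [j] contributes this factor to [U^k V^(s_b k)]. *)
Definition Y j := mono (b ^ j) 1.
Definition W j := mono (s * b ^ j) s.
Definition Q := mono 0 (b.-1 * s).

Lemma Y_isometry j : lin_isometry ip (Y j). Proof. exact: isometry_mono. Qed.
Lemma W_isometry j : lin_isometry ip (W j). Proof. exact: isometry_mono. Qed.
Lemma Q_isometry : lin_isometry ip Q. Proof. exact: isometry_mono. Qed.
Lemma Y_bicommutant j : bicommutant (Y j). Proof. exact: bicommutant_mono. Qed.
Lemma W_bicommutant j : bicommutant (W j). Proof. exact: bicommutant_mono. Qed.
Lemma Q_bicommutant : bicommutant Q. Proof. exact: bicommutant_mono. Qed.

Lemma WQ j x : W j.+1 (Q x) = iter b (W j) x.
Proof.
rewrite iter_mono /W /Q mono_comp addn0 -mulSn prednK //; congr (mono _ _ x).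
by rewrite expnS mulnCA.
Qed.

Lemma W_Y j x : W j x = iter s (Y j) x.
Proof. by rewrite iter_mono muln1. Qed.

Fixpoint A j x : H := if j is j'.+1 then mean (digits D) (Y j') (A j' x) else x.

Lemma bicommutant_A j : bicommutant (A j).
Proof.
elim: j => [|j IH]; first exact: bicommutant_id.
exact: bicommutant_comp (bicommutant_mean _ (Y_bicommutant _)) IH.
Qed.

Lemma A_step j x : nr (A j.+1 x) <= nr (A j x).
Proof. exact: (mean_contract ipP _ (Y_isometry j) D0). Qed.

Lemma A_le t n x : nr (A (t + n) x) <= nr (A t x).
Proof.
by elim: n => [|n IH]; rewrite ?addn0 // addnS; apply: le_trans (A_step _ _) IH.
Qed.

Lemma A_contract n x : nr (A n x) <= nr x.
Proof. exact: (A_le 0). Qed.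

(** By [A_le] the norms [nr (A n x)] are nonincreasing, so this says that [A n x -> 0]. *)
Definition null x := forall eps : R, 0 < eps -> exists n, nr (A n x) < eps.

Lemma nullD x y : null x -> null y -> null (x + y).
Proof.
move=> hx hy eps e0; have e2 : 0 < eps / 2 by rewrite divr_gt0.
have [[n hn] [m hm]] := (hx _ e2, hy _ e2); exists (n + m)%N.
rewrite (linD (bicommutant_A _).1); apply: le_lt_trans (nrD _ _) _.
have := A_le n m x; have := A_le m n y; rewrite (addnC m); lra.
Qed.

Lemma null_adherent x : adherent null x -> null x.
Proof.
move=> h eps e0; have e2 : 0 < eps / 2 by rewrite divr_gt0.
have [z hz xz] := h _ e2; have [n hn] := hz _ e2; exists n.
have -> : A n x = A n (x - z) + A n z by rewrite -(linD (bicommutant_A _).1) subrK.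
by apply: le_lt_trans (nrD _ _) _; have := A_contract n (x - z); lra.
Qed.

Lemma A_tail x (eps : R) : 0 < eps ->
  exists t, forall n, nr (A t x) ^+ 2 - nr (A (t + n) x) ^+ 2 < eps.
Proof.
move=> e0; pose E : set R := [set nr (A t x) ^+ 2 | t in [set: nat]].
have Einf : has_inf E.
  split; first by exists (nr (A 0 x) ^+ 2), 0%N.
  by exists 0 => _ [t _ <-]; exact: sqr_ge0.
have [_ [t _ <-] ht] := inf_adherent e0 Einf; exists t => n.
have : inf E <= nr (A (t + n) x) ^+ 2.
  by apply: ge_inf; [exact: Einf.2 | exists (t + n)%N].
lra.
Qed.

Lemma W_defect : exists2 C : R, 0 <= C & forall j x,
  nr (W j (A j x) - A j x) ^+ 2 <= C * (nr (A j x) ^+ 2 - nr (A j.+1 x) ^+ 2).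
Proof.
have [C C0 h] := digit_gcd_defect ipP D; exists C => // j x.
by rewrite W_Y; apply: h; exact: Y_isometry.
Qed.

(** The further factors of [A (j + n)] are contractions commuting with [W j - 1]. *)
Lemma W_A_mono j n x :
  nr (W j (A (j + n) x) - A (j + n) x) <= nr (W j (A j x) - A j x).
Proof.
elim: n => [|n IH]; rewrite ?addn0 // addnS /=; apply: le_trans IH.
rewrite -(mean_comm _ _ (W_isometry j).1); last first.
  by move=> y; apply: bicommutant_comm; [exact: Y_bicommutant | exact: W_bicommutant].
rewrite -(linB (mean_lin _ (Y_isometry _).1)); exact: (mean_contract ipP _ (Y_isometry _) D0).
Qed.

(** [W_defect] bounds the square by a one-step drop of [|A j x|^2], and late drops are small by
    [A_tail]. *)
Lemma W_A_small x (eps : R) : 0 < eps ->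
  exists t, forall j, (t <= j)%N -> nr (W j (A j x) - A j x) < eps.
Proof.
move=> e0; have [C C0 h] := W_defect.
have C1 : 0 < C + 1 by rewrite ltr_wpDl.
have [t ht] := A_tail x (divr_gt0 (exprn_gt0 2 e0) C1); exists t => j tj.
rewrite -(@ltr_pXn2r _ 2) ?nnegrE ?nr_ge0 ?ltW //; apply: le_lt_trans (h j x) _.
have h1 : nr (A j x) ^+ 2 <= nr (A t x) ^+ 2.
  by rewrite ler_sqr ?nnegrE ?nr_ge0 // -(subnKC tj) A_le.
have h2 : nr (A j.+1 x) ^+ 2 <= nr (A j x) ^+ 2.
  by rewrite ler_sqr ?nnegrE ?nr_ge0 // A_step.
have := ht (j.+1 - t)%N; rewrite subnKC; last exact: leqW.
rewrite ltr_pdivlMr // => h3.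
have : 0 <= nr (A j x) ^+ 2 - nr (A j.+1 x) ^+ 2 by rewrite subr_ge0.
nra.
Qed.

(** Applying the isometry [W t.+1] turns [Q y - y] into [W_t^b y - W_(t+1) y], by [WQ]. *)
Lemma nr_QB t y :
  nr (Q y - y) <= b%:R * nr (W t y - y) + nr (W t.+1 y - y).
Proof.
rewrite -(isometry_nr ipP _ (W_isometry t.+1)) (linB (W_isometry _).1) WQ.
have -> : iter b (W t) y - W t.+1 y = (iter b (W t) y - y) - (W t.+1 y - y).
  by rewrite opprB addrA subrK.
apply: le_trans (nrB _ _) _; rewrite lerD2r.
exact: (nr_iter_sub ipP _ _ (W_isometry t)).
Qed.

(** [A n] commutes with [Q], and [A t.+1 u] is almost fixed by both [W t] and [W t.+1] for large
    [t], hence by [Q]. The coefficients in [nr_QB] add up to [b + 1]. *)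
Lemma null_QB u : null (Q u - u).
Proof.
move=> eps e0; have bp1 : 0 < b%:R + 1 :> R by rewrite ltr_wpDl.
have [t ht] := W_A_small u (divr_gt0 e0 bp1); exists t.+1.
rewrite (linB (bicommutant_A _).1) (bicommutant_comm (bicommutant_A _) Q_bicommutant).
apply: le_lt_trans (nr_QB t _) _.
have h1 := ht t (leqnn _); have h2 := ht t.+1 (leqnSn _).
have h3 := W_A_mono t 1 u; rewrite addn1 in h3.
have bp : 0 < b%:R :> R by rewrite ltr0n.
have -> : eps = b%:R * (eps / (b%:R + 1)) + eps / (b%:R + 1) by field; rewrite gt_eqF.
by apply: ltrD => //; rewrite ltr_pM2l //; apply: le_lt_trans h3 h1.
Qed.

Lemma fixed_adherent (P : H -> Prop) f x : lin_isometry ip f ->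
  (forall z, P z -> f z = z) -> adherent P x -> f x = x.
Proof.
move=> fi h a; apply/eqP; rewrite -subr_eq0; apply/eqP/nr_eq0/eqP.
rewrite eq_le nr_ge0 andbT; apply/ler_addgt0Pr => eps e0; rewrite add0r.
have [z Pz xz] := a _ (divr_gt0 e0 (ltr0Sn _ 1)).
have -> : f x - x = f (x - z) - (x - z).
  by rewrite (linB fi.1) (h _ Pz) opprB addrA subrK.
apply: le_trans (nrB _ _) _; rewrite (isometry_nr ipP _ fi); lra.
Qed.

(** For an isometry, [|f z - z|^2 = - 2 <z, f z - z>]. *)
Lemma fixed_of_orth f z : lin_isometry ip f -> rip z (f z - z) = 0 -> f z = z.
Proof.
move=> fi h; apply/eqP; rewrite -subr_eq0; apply/eqP/nr_eq0/eqP.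
rewrite -sqrf_eq0 (nr_sqB ipP) (isometry_nr ipP _ fi) (ripC ipP).
move: h; rewrite (ripBr ipP) => /eqP; rewrite subr_eq0 => /eqP ->.
by rewrite (ripxx ipP); apply/eqP; ring.
Qed.

Lemma orth_range f u e : lin_isometry ip f -> f e = e -> rip (f u - u) e = 0.
Proof. by move=> fi h; rewrite (ripBl ipP) -{1}h fi.2 subrr. Qed.

Definition eventually_fixed e := exists T, forall j, (T <= j)%N -> W j e = e.

Lemma eventually_fixed_Q e : eventually_fixed e -> Q e = e.
Proof.
case=> T hT; have Wi := W_isometry T.+1.
apply/eqP; rewrite -subr_eq0; apply/eqP/nr_eq0.
rewrite -(isometry_nr ipP _ Wi) (linB Wi.1) WQ hT ?leqnSn //.
have -> : iter b (W T) e = e by elim: b => //= n ->; rewrite hT.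
by rewrite subrr nr0.
Qed.

(** On vectors fixed by [Q], [WQ] becomes [W_(j+1) e = W_j^b e], so invariance passes from each
    level to the next. *)
Lemma W_Q_fixed t e : Q e = e -> W t e = e -> eventually_fixed e.
Proof.
move=> Qe We; exists t => j /subnKC <-; elim: (j - t)%N => [|n IH]; first by rewrite addn0.
rewrite addnS -{1}Qe WQ; elim: b => //= m ->; exact: IH.
Qed.

(** On vectors fixed by [Q], [W_(t+i)] acts as the power [b^i] of [W_t], so by base-[b] expansion
    this is the mean of the first [b^n] powers of [W_t]. *)
Fixpoint M t n x : H :=
  if n is n'.+1 then mean (iota 0 b) (W (t + n')) (M t n' x) else x.

Lemma bicommutant_M t n : bicommutant (M t n).
Proof.
elim: n => [|n IH]; first exact: bicommutant_id.
exact: bicommutant_comp (bicommutant_mean _ (W_bicommutant _)) IH.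
Qed.

Lemma M_contract t n x : nr (M t n x) <= nr x.
Proof.
elim: n => //= n IH; apply: le_trans IH.
by apply: (mean_contract ipP _ (W_isometry _)); rewrite size_iota.
Qed.

(** [mean_defect_le] is applied factor by factor; the earlier factors are contractions commuting
    with [W (t + n)], so its displacement may be measured at [y] itself. *)
Lemma M_defect t n y :
  nr y ^+ 2 - nr (M t n y) ^+ 2 <=
  2 * b%:R ^+ 2 * \sum_(j < n) nr (W (t + j) y - y) ^+ 2.
Proof.
elim: n => [|n IH]; first by rewrite big_ord0 mulr0 subrr.
rewrite big_ord_recr /= mulrDr.
have h := mean_defect_le ipP (M t n y) (W_isometry (t + n)) b0.
have h1 : nr (W (t + n) (M t n y) - M t n y) ^+ 2 <= nr (W (t + n) y - y) ^+ 2.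
  rewrite ler_sqr ?nnegrE ?nr_ge0 //.
  rewrite -(bicommutant_comm (bicommutant_M _ _) (W_bicommutant _)).
  rewrite -(linB (bicommutant_M _ _).1); exact: M_contract.
have h2 := ler_wpM2l (_ : 0 <= 2 * b%:R ^+ 2) h1.
rewrite mulr_ge0 ?sqr_ge0 // in h2; have := h2 isT; lra.
Qed.

(** The vector [y = A (t + n) x] is almost fixed by each [W j] with [t <= j < t + n], so [M t n]
    hardly shortens it, while [M t n y = A (t + n) (M t n x)]. The displacement bounds telescope to
    the tail of [|A j x|^2]. *)
Lemma A_energy (C : R) : 0 <= C ->
  (forall j x, nr (W j (A j x) - A j x) ^+ 2 <= C * (nr (A j x) ^+ 2 - nr (A j.+1 x) ^+ 2)) ->
  forall t n x, nr (A (t + n) x) ^+ 2 <=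
    nr (M t n x) ^+ 2 + 2 * b%:R ^+ 2 * C * (nr (A t x) ^+ 2 - nr (A (t + n) x) ^+ 2).
Proof.
move=> C0 h t n x; set y := A (t + n) x.
have h1 : nr (M t n y) <= nr (M t n x).
  rewrite /y (bicommutant_comm (bicommutant_M _ _) (bicommutant_A _)); exact: A_contract.
have {}h1 : nr (M t n y) ^+ 2 <= nr (M t n x) ^+ 2 by rewrite ler_sqr ?nnegrE ?nr_ge0.
have h2 := M_defect t n y.
have h3 : \sum_(j < n) nr (W (t + j) y - y) ^+ 2 <=
   C * (nr (A t x) ^+ 2 - nr (A (t + n) x) ^+ 2).
  apply: le_trans (_ : \sum_(j < n) C * (nr (A (t + j) x) ^+ 2 - nr (A (t + j).+1 x) ^+ 2) <= _).
    apply: ler_sum => j _; apply: le_trans (h _ _).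
    rewrite ler_sqr ?nnegrE ?nr_ge0 // /y.
    have -> : (t + n = t + j + (n - j))%N by rewrite -addnA subnKC // ltnW.
    exact: W_A_mono.
  rewrite -mulr_sumr ler_wpM2l //; rewrite le_eqVlt; apply/orP; left; apply/eqP.
  elim: n {y h1 h2} => [|n IH]; first by rewrite big_ord0 addn0 subrr.
  by rewrite big_ord_recr /= IH addnS addrA subrK.
have b2 : 0 <= 2 * b%:R ^+ 2 :> R by rewrite mulr_ge0 ?sqr_ge0.
have := ler_wpM2l b2 h3; rewrite mulrA; lra.
Qed.

(* Telescoping: the sum of the powers W_j^i, i < b, times (W_j - 1) is W_j^b - 1. *)
Lemma M_telescope t n u : Q u = u ->
  M t n (W t u - u) = ((b ^ n)%:R : R[i])^-1 *: (W (t + n) u - u).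
Proof.
move=> Qu; elim: n => [|n IH]; first by rewrite /= addn0 expn0 invr1 scale1r.
rewrite /= IH (linZ (mean_lin _ (W_isometry _).1)) /mean size_iota scalerA.
have WQu : W (t + n).+1 u = iter b (W (t + n)) u by rewrite -{1}Qu WQ.
rewrite -invfM -natrM -expnSr addnS WQu; congr (_ *: _).
have Wi := W_isometry (t + n).
elim: b => [|m IHm]; first by rewrite big_nil subrr.
rewrite -{1}addn1 iotaD big_cat IHm big_seq1 add0n (linB (lin_iter Wi.1 m)).
by rewrite -iterSr [LHS]addrC addrA subrK.
Qed.

(** Mean ergodic argument inside the fixed space of [Q]. Let [p] be the projection of [z] to the
    closure of the vectors [W t u - u] with [Q u = u]. Then [z - p] is fixed by [Q] and [W t], hence
    eventually fixed, hence orthogonal to both [z] and [p]; so [z = p], and [M_telescope] applies to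
    approximants. *)
Lemma M_vanish z t : Q z = z -> (forall e, eventually_fixed e -> rip z e = 0) ->
  forall eps : R, 0 < eps -> exists n, nr (M t n z) < eps.
Proof.
move=> Qz zS; pose P w := exists2 u, Q u = u & w = W t u - u.
have Wi := W_isometry t; have Qi := Q_isometry.
have [|u v [u' Qu ->] [v' Qv ->]|a u [u' Qu ->]|p pP hp] := @projection _ _ _ ipP P z.
- by exists 0; rewrite ?(lin0 Qi.1) ?(lin0 Wi.1) ?subrr.
- exists (u' + v'); first by rewrite (linD Qi.1) Qu Qv.
  by rewrite (linD Wi.1) opprD addrACA.
- exists (a%:C%C *: u'); first by rewrite (linZ Qi.1) Qu.
  by rewrite (linZ Wi.1) scalerBr.
have Qp : Q p = p.
  apply: (fixed_adherent Qi _ pP) => _ [u Qu ->].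
  rewrite (linB Qi.1) Qu; congr (_ - _).
  by rewrite (bicommutant_comm Q_bicommutant (W_bicommutant _)) Qu.
have Qzp : Q (z - p) = z - p by rewrite (linB Qi.1) Qz Qp.
(* Orthogonality is tested against [W t u - u] with [u = z - p] itself. *)
have Wzp : W t (z - p) = z - p by apply: (fixed_of_orth Wi); apply: hp; exists (z - p).
have zp : z - p = 0.
  apply: nr_eq0; apply/eqP; rewrite -sqrf_eq0 -(ripxx ipP) {1}(ripBl ipP).
  rewrite zS; last exact: (W_Q_fixed Qzp Wzp).
  rewrite (adherent_orth ipP _ pP) ?subrr // => _ [u _ ->].
  exact: orth_range.
have {}zp : z = p by apply/eqP; rewrite -subr_eq0 zp.
move=> eps e0; have e2 : 0 < eps / 2 by rewrite divr_gt0.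
rewrite -zp in pP; have [_ [u Qu ->] zu] := pP _ e2.
(* Since [n < b ^ n], this makes [2 |u| / b^n] smaller than [eps / 2]. *)
have [n hn] : exists n, 4 * nr u / eps < n%:R.
  exists (Num.bound (4 * nr u / eps)); apply: archi_boundP.
  by rewrite divr_ge0 ?mulr_ge0 ?nr_ge0 // ltW.
exists n.
have -> : M t n z = M t n (z - (W t u - u)) + M t n (W t u - u).
  by rewrite -(linD (bicommutant_M _ _).1) subrK.
apply: le_lt_trans (nrD _ _) _; rewrite (M_telescope _ _ Qu) nrZV.
have h1 := M_contract t n (z - (W t u - u)).
have h2 : nr (W (t + n) u - u) <= 2 * nr u.
  apply: le_trans (nrB _ _) _; rewrite (isometry_nr ipP _ (W_isometry _)); lra.
have bn : 0 < (b ^ n)%:R :> R by rewrite ltr0n expn_gt0 b0.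
have h3 : 4 * nr u < (b ^ n)%:R * eps.
  rewrite -ltr_pdivrMr //; apply: lt_le_trans hn _.
  by rewrite ler_nat ltnW // ltn_expl.
have h4 (B : R) : 0 < B -> 4 * nr u < B * eps -> B^-1 * nr (W (t + n) u - u) < eps / 2.
  by move=> B0 hB; rewrite mulrC ltr_pdivrMr //; apply: le_lt_trans h2 _; lra.
have := h4 _ bn h3; set w := _ * _ => h5; lra.
Qed.

(** Split off the projection [p] to the closed range of [Q - 1], which is null. The rest is fixed by
    [Q] and still orthogonal to the eventually fixed vectors, so [M_vanish] and [A_energy] apply to
    it. *)
Lemma null_of_orth_fixed x :
  (forall e, eventually_fixed e -> rip x e = 0) -> null x.
Proof.
move=> xS; pose P w := exists u, w = Q u - u.
have Qi := Q_isometry.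
have [|u v [u' ->] [v' ->]|a u [u' ->]|p pP hp] := @projection _ _ _ ipP P x.
- by exists 0; rewrite (lin0 Qi.1) subrr.
- by exists (u' + v'); rewrite (linD Qi.1) opprD addrACA.
- by exists (a%:C%C *: u'); rewrite (linZ Qi.1) scalerBr.
have np : null p.
  apply: null_adherent => eps e0; have [_ [u ->] h] := pP _ e0.
  by exists (Q u - u) => //; exact: null_QB.
rewrite -[x](subrK p); apply: nullD => //.
have Qz : Q (x - p) = x - p by apply: (fixed_of_orth Qi); apply: hp; exists (x - p).
have zS e : eventually_fixed e -> rip (x - p) e = 0.
  move=> eS; rewrite (ripBl ipP) xS // (adherent_orth ipP _ pP) ?subrr // => _ [u ->].
  by apply: (orth_range _ Qi); exact: eventually_fixed_Q.
move=> eps e0; have [C C0 hC] := W_defect.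
set K := 2 * b%:R ^+ 2 * C; have K0 : 0 <= K by rewrite !mulr_ge0 ?sqr_ge0.
have K1 : 0 < K + 1 by rewrite ltr_wpDl.
have e2 : 0 < eps / 2 by rewrite divr_gt0.
(* First [t] makes the tail term of [A_energy] less than [(eps / 2)^2], uniformly in [n]; then [n]
   is chosen for this [t]. *)
have [t ht] := A_tail (x - p) (divr_gt0 (exprn_gt0 2 e2) K1).
have [n hn] := M_vanish t Qz zS e2; exists (t + n)%N.
rewrite -(@ltr_pXn2r _ 2) ?nnegrE ?nr_ge0 ?ltW //.
apply: le_lt_trans (A_energy C0 hC t n (x - p)) _.
move: (ht n); rewrite ltr_pdivlMr // -/K; set a := _ - _ => ha.
have a0 : 0 <= a by rewrite subr_ge0 ler_sqr ?nnegrE ?nr_ge0 // A_le.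
have h1 : nr (M t n (x - p)) ^+ 2 < (eps / 2) ^+ 2.
  by rewrite ltr_pXn2r ?nnegrE ?nr_ge0 ?ltW.
have -> : eps ^+ 2 = 4 * (eps / 2) ^+ 2 by field.
nra.
Qed.

End Dynamics.

(** * Numbers with restricted digits *)

Section DigitSets.
Context (b : nat) (b1 : (1 < b)%N) (D : {set 'I_b}).
Let b0 : (0 < b)%N := ltnW b1.

Lemma sumdigits_extend n m : (n <= m)%N ->
  sumdigits b n = (\sum_(j < m.+1) (n %/ b ^ j) %% b)%N.
Proof.
move=> nm; rewrite /sumdigits -!(big_mkord xpredT (fun j => (n %/ b ^ j) %% b)%N).
rewrite [RHS](big_cat_nat (n := n.+1)) //= [X in (_ + X)%N](_ : _ = 0%N) ?addn0 //.
rewrite big_nat_cond big1 // => j /andP[/andP[nj _] _]; rewrite divn_small ?mod0n //.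
by apply: leq_trans (ltn_expl n b1) _; rewrite leq_pexp2l // ltnW.
Qed.

Lemma sumdigits_step d q : (d < b)%N -> sumdigits b (d + b * q) = (d + sumdigits b q)%N.
Proof.
move=> db; rewrite (sumdigits_extend (leqnSn _)) big_ord_recl expn0 divn1.
rewrite (addnC d (b * q)%N) (mulnC b) modnMDl modn_small //; congr (_ + _)%N.
rewrite (@sumdigits_extend q (q * b + d)); last first.
  by apply: leq_trans (leq_addr _ _); rewrite leq_pmulr.
by apply: eq_bigr => j _; rewrite expnS divnMA divnMDl // (divn_small db) addn0.
Qed.

Definition numeral (ds : seq 'I_b) :=
  (\sum_(j < size ds) nth 0 (map val ds) j * b ^ j)%N.

Lemma numeral_cons d ds : numeral (d :: ds) = (d + b * numeral ds)%N.
Proof.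
rewrite /numeral /= big_ord_recl /= expn0 muln1; congr (_ + _)%N.
by rewrite big_distrr /=; apply: eq_bigr => j _; rewrite expnS mulnCA.
Qed.

(** The lowest digit is the residue mod [b]. For [q = 0] the equivalence can fail: the one-digit
    number [d] may belong to the set while [0] does not. *)
Lemma digit_set_step (d : 'I_b) q : (0 < q)%N ->
  digit_set D (d + b * q)%N <-> d \in D /\ digit_set D q.
Proof.
move=> q0; split=> [[ds [_ aD e]]|[dD [ds [s0 aD e]]]]; last first.
  by exists (d :: ds); split; rewrite /= ?dD // -/(numeral (d :: ds)) numeral_cons e.
case: ds aD e => [_|d' ds /= /andP[d'D aD]].
  by rewrite big_ord0 => /eqP; rewrite addn_eq0 muln_eq0 !eqn0Ngt b0 q0 andbF.
rewrite -/(numeral (d' :: ds)) numeral_cons => e.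
have lowest (c : 'I_b) n : ((c + b * n) %% b)%N = c.
  by rewrite addnC mulnC modnMDl modn_small.
have ed : d = d' :> nat by have := congr1 (modn^~ b) e; rewrite !lowest.
have eq : q = numeral ds.
  by move: e; rewrite ed => /addnI /eqP; rewrite eqn_pmul2l // => /eqP.
split; first by rewrite (val_inj ed).
by exists ds; split => //; case: ds eq {aD e} => // e; rewrite e /numeral big_ord0 in q0.
Qed.

Local Notation C n := `[< digit_set D n >].

(** Induction on [Q]: the members of the block from [b Q] to [b Q + b - 1] are exactly the [d + b Q]
    with [d] in [D] if [Q] is a member, and there are none otherwise. *)
Lemma sum_blocks (W : nmodType) (f : nat -> W) P Q : (0 < P)%N ->
  \sum_(b * P <= k < b * Q | C k) f k =
  \sum_(P <= q < Q | C q) \sum_(d <- digits D) f (d + b * q)%N.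
Proof.
move=> P0; elim: Q => [|Q IH]; first by rewrite muln0 !big_geq.
have [PQ|QP] := leqP P Q; last by rewrite !big_geq // leq_mul2l QP orbT.
rewrite [RHS]big_mkcond big_nat_recr //= -big_mkcond -IH mulnS addnC.
rewrite (big_cat_nat (n := (b * Q)%N)) ?leq_mul2l ?PQ ?orbT ?leq_addr //=; congr (_ + _).
have Q0 : (0 < Q)%N by exact: leq_trans PQ.
rewrite -{1}[(b * Q)%N]add0n (addnC _ b) big_addn addnK big_mkord big_mkcond /=.
rewrite /digits big_map big_enum /=.
have [CQ|nCQ] := asboolP (digit_set D Q).
  rewrite [RHS]big_mkcond; apply: eq_bigr => d _; case: asboolP => h.
    by have [-> _] := (digit_set_step d Q0).1 h.
  by case: ifP => // dD; case: h; apply/digit_set_step.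
apply: big1 => d _; case: asboolP => // h.
by have [_ ?] := (digit_set_step d Q0).1 h.
Qed.

Lemma count_blocks l P Q : (0 < P)%N ->
  (\sum_(b ^ l * P <= k < b ^ l * Q | C k) 1 =
  size (digits D) ^ l * \sum_(P <= q < Q | C q) 1)%N.
Proof.
elim: l P Q => [|l IH] P Q P0; first by rewrite !expn0 !mul1n.
rewrite !expnSr -!mulnA IH ?muln_gt0 ?b0 //; congr (_ * _)%N.
rewrite (@sum_blocks nat) // big_distrr /=; apply: eq_bigr => q _.
by rewrite sum_const_seq muln1 natn.
Qed.

(** The first [N] members are exactly those below [k N], because [k] is indexed from [0]. *)
Lemma sum_enumeration (k : nat -> nat) (W : nmodType) (f : nat -> W) N :
  (forall n m, (n < m)%N -> (k n < k m)%N) -> range k = digit_set D ->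
  \sum_(i < N) f (k i) = \sum_(0 <= j < k N | C j) f j.
Proof.
move=> kmono kC.
have klt n m : (k n < k m)%N = (n < m)%N.
  have [nm|] := ltnP n m; first exact: kmono.
  rewrite leq_eqVlt => /orP[/eqP ->|/kmono mn]; first exact: ltnn.
  by rewrite ltnNge ltnW.
rewrite -(big_mkord xpredT (fun i => f (k i))) -[LHS](big_map k xpredT f).
rewrite -[RHS]big_filter; apply: perm_big; apply: uniq_perm.
- rewrite map_inj_uniq ?iota_uniq // => n m e.
  by have [nm|mn|//] := ltngtP n m; [have := kmono _ _ nm | have := kmono _ _ mn];
    rewrite e ltnn.
- by rewrite filter_uniq // iota_uniq.
move=> j; rewrite mem_filter mem_index_iota /=; apply/mapP/andP.
  case=> i; rewrite mem_index_iota /= => iN ->; rewrite klt iN; split=> //.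
  by apply/asboolP; rewrite -kC; exists i.
case=> /asboolP; rewrite -kC => -[i _ <-]; rewrite klt => iN.
by exists i; rewrite ?mem_index_iota.
Qed.

End DigitSets.

(** * Ergodic averages *)

Section Averages.
Context {R : realType} {H : completeNormedModType R[i]}.
Context (ip : H -> H -> R[i]) (ipP : is_inner_product ip).
Context (U V : H -> H) (Ui : lin_isometry ip U) (Vi : lin_isometry ip V).
Context (UV : forall x, U (V x) = V (U x)).
Context (b : nat) (b1 : (1 < b)%N) (D : {set 'I_b}) (D0 : (0 < size (digits D))%N).
Local Notation C n := `[< digit_set D n >].
Local Notation mono := (mono U V).
Local Notation A := (A U V D).
Let b0 : (0 < b)%N := ltnW b1.

Lemma digits_ltn d : d \in digits D -> (d < b)%N.
Proof. by case/mapP => i _ ->; exact: ltn_ord. Qed.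

Lemma mono_nr p q x : nr (mono p q x) = nr x.
Proof. exact: (isometry_nr ipP _ (isometry_mono Ui Vi _ _)). Qed.

(** Each use of [sum_blocks] strips one low digit, and summing over it produces [size (digits D)]
    times the next factor of [A]. *)
Lemma mono_sum_blocks l P Q x : (0 < P)%N ->
  \sum_(b ^ l * P <= k < b ^ l * Q | C k) mono k (sumdigits b k) x =
  ((size (digits D) ^ l)%:R : R[i]) *:
    \sum_(P <= q < Q | C q) mono (b ^ l * q) (sumdigits b q) (A l x).
Proof.
elim: l P Q => [|l IH] P Q P0.
  by rewrite !expn0 !mul1n scale1r; apply: eq_bigr => q _; rewrite mul1n.
rewrite !expnSr -!mulnA IH ?muln_gt0 ?b0 // natrM -scalerA; congr (_ *: _).
rewrite sum_blocks // scaler_sumr; apply: eq_bigr => q _.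
have ml := (isometry_mono Ui Vi (b ^ l * (b * q)) (sumdigits b q)).1.
rewrite -mulnA -(linZ ml) /= /mean scalerA mulfV ?scale1r; last by rewrite pnatr_eq0 -lt0n.
rewrite (linS ml) big_seq [RHS]big_seq; apply: eq_bigr => d /digits_ltn db.
rewrite /Y iter_mono // mono_comp // sumdigits_step // muln1.
by rewrite mulnDr !(addnC d) (mulnC d) (addnC (_ * d)%N).
Qed.

(** Outside the complete blocks remain an initial block and a final piece of at most [B] terms,
    costing [B K] each. *)
Lemma nr_boundary_blocks (f : nat -> H) (K : R) B X :
  (0 < B)%N -> (forall k, nr (f k) <= K) ->
  nr (\sum_(0 <= k < X | C k) f k) <=
  2 * B%:R * K + nr (\sum_(B <= k < B * (X %/ B) | C k) f k).
Proof.
move=> B0 fK; have K0 : 0 <= K := le_trans (nr_ge0 _) (fK 0%N).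
have bound m n : (n - m <= B)%N -> nr (\sum_(m <= k < n | C k) f k) <= B%:R * K.
  move=> mn; apply: le_trans (nr_sum _ _ _) _; rewrite big_mkcond.
  apply: le_trans (_ : \sum_(m <= k < n) K <= _).
    by apply: ler_sum => k _; case: ifP.
  by rewrite sumr_const_nat -[K *+ _]mulr_natl ler_wpM2r // ler_nat.
have BK : 0 <= B%:R * K by rewrite mulr_ge0.
have [XB|BX] := ltnP X B.
  have := bound 0 X; rewrite subn0 => /(_ (ltnW XB)) h.
  have := nr_ge0 (\sum_(B <= k < B * (X %/ B) | C k) f k); lra.
set Y := (B * (X %/ B))%N.
have YX : (Y <= X)%N by rewrite /Y mulnC leq_trunc_div.
have BY : (B <= Y)%N by rewrite /Y leq_pmulr // divn_gt0.
rewrite (big_cat_nat (n := B)) //= (big_cat_nat (m := B) (n := Y)) //=.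
have h1 := bound 0 B; rewrite subn0 in h1; have {}h1 := h1 (leqnn _).
have h2 : nr (\sum_(Y <= k < X | C k) f k) <= B%:R * K.
  apply: bound; rewrite leq_subLR /Y mulnC {1}(divn_eq X B) leq_add2l.
  by rewrite ltnW // ltn_mod.
have := nrD (\sum_(0 <= k < B | C k) f k)
  (\sum_(B <= k < Y | C k) f k + \sum_(Y <= k < X | C k) f k).
have := nrD (\sum_(B <= k < Y | C k) f k) (\sum_(Y <= k < X | C k) f k).
lra.
Qed.

Context (k : nat -> nat) (kmono : forall n m, (n < m)%N -> (k n < k m)%N).
Context (kC : range k = digit_set D).
Local Notation avg := (erg_avg b k U V).

Lemma avgE x N : avg x N = ((N%:R : R[i])^-1) *:
  \sum_(0 <= j < k N | C j) mono j (sumdigits b j) x.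
Proof.
by rewrite /erg_avg -(sum_enumeration (fun j => mono j (sumdigits b j) x) N kmono kC).
Qed.

Lemma count_below N : (\sum_(0 <= j < k N | C j) 1)%N = N.
Proof.
by rewrite -(@sum_enumeration _ _ k nat (fun=> 1%N) N kmono kC) sum_nat_const card_ord muln1.
Qed.

Lemma avgB x y N : avg (x - y) N = avg x N - avg y N.
Proof.
rewrite !avgE -scalerBr -sumrB; congr (_ *: _); apply: eq_bigr => j _.
exact: (linB (isometry_mono Ui Vi _ _).1).
Qed.

Lemma avg_contract x N : nr (avg x N) <= nr x.
Proof.
rewrite /erg_avg nrZV; have [->|N0] := posnP N; first by rewrite invr0 mul0r nr_ge0.
rewrite mulrC ler_pdivrMr ?ltr0n //; apply: le_trans (nr_sum _ _ _) _.
rewrite (eq_bigr (fun=> nr x)) => [|i _]; last exact: mono_nr.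
by rewrite sumr_const card_ord -[_ *+ _]mulr_natr.
Qed.

Lemma small_quotient (K eps : R) : 0 <= K -> 0 < eps ->
  exists N0 : nat, forall N, (N0 <= N)%N -> N%:R^-1 * K < eps.
Proof.
move=> K0 e0; exists (Num.bound (K / eps)).+1 => N NN.
have N1 : 0 < N%:R :> R by rewrite ltr0n (leq_trans _ NN).
rewrite mulrC ltr_pdivrMr // mulrC -ltr_pdivrMr //.
apply: lt_le_trans (archi_boundP _) _; first by rewrite divr_ge0 // ltW.
by rewrite ler_nat ltnW.
Qed.

(** Fix [l] with [A l x] small. Complete blocks of length [b ^ l] contribute at most [N |A l x|] by
    [mono_sum_blocks]; the boundary cost is independent of [N]. *)
Lemma avg_null x : null U V D x -> converges (avg x) 0.
Proof.
move=> hx eps e0; have e2 : 0 < eps / 2 by rewrite divr_gt0.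
have [l hl] := hx _ e2; set B := (b ^ l)%N; have B0 : (0 < B)%N by rewrite expn_gt0 b0.
have K0 : 0 <= 2 * B%:R * nr x by rewrite !mulr_ge0 ?nr_ge0.
have [N0 hN0] := small_quotient K0 e2; exists N0.+1 => N NN; rewrite subr0.
have h0 := hN0 N (ltnW NN); have N1 : (0 < N)%N := leq_trans (ltn0Sn _) NN.
have NR : 0 < N%:R :> R by rewrite ltr0n.
rewrite avgE nrZV.
have h1 := @nr_boundary_blocks (fun j => mono j (sumdigits b j) x) (nr x) B (k N) B0
  (fun j => eq_ind_r (fun t => is_true (t <= nr x)) (lexx _) (mono_nr _ _ x)).
have h2 : nr (\sum_(B <= j < B * (k N %/ B) | C j) mono j (sumdigits b j) x)
    <= N%:R * (eps / 2).
  rewrite -{1}[B]muln1 mono_sum_blocks // natrC nrZr ger0_norm //.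
  set Q := (k N %/ B)%N.
  apply: le_trans (_ : (size (digits D) ^ l)%:R *
     (\sum_(1 <= q < Q | C q) 1)%N%:R * nr (A l x) <= _).
    rewrite -mulrA ler_wpM2l //; apply: le_trans (nr_sum _ _ _) _.
    rewrite natr_sum mulr_suml; apply: ler_sum => q _.
    by rewrite mono_nr mul1r.
  rewrite -natrM -(count_blocks b1) //; apply: ler_pM; rewrite ?nr_ge0 //; last exact: ltW.
  (* The members in complete blocks are among the [N] members below [k N]. *)
  rewrite muln1 ler_nat -/B -[leqRHS](count_below N).
  have [Q0|Q0] := posnP Q; first by rewrite Q0 muln0 big_geq.
  rewrite (big_cat_nat (n := B) (p := k N)) //=; last first.
    by apply: leq_trans (leq_trunc_div (k N) B); rewrite leq_pmull.
  rewrite (big_cat_nat (n := (B * Q)%N) (p := k N)) ?leq_pmulr //=.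
    by rewrite addnCA leq_addr.
  by rewrite mulnC leq_trunc_div.
rewrite mulrC ltr_pdivrMr //; rewrite mulrC ltr_pdivrMr // in h0.
by move: (N%:R : R) h0 h2 NR h1 => c; lra.
Qed.

(** Induction on the digit word: a digit [d = c s] at position [T] acts as [W_T^c], which fixes [e],
    and the remaining word starts at position [T + 1]. *)
Lemma mono_fixed e T : (forall d, d \in D -> (digit_gcd D %| d)%N) ->
  (forall j, (T <= j)%N -> W U V D j e = e) ->
  forall q, digit_set D q -> mono (b ^ T * q) (sumdigits b q) e = e.
Proof.
move=> sD hT q [ds [_ aD ->]]; rewrite -/(numeral ds).
elim: ds aD T hT => [|d ds IH] /= => [_|/andP[dD aD]] T hT.
  have -> : numeral ([::] : seq 'I_b) = 0%N by exact: big_ord0.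
  by rewrite muln0 /sumdigits big_ord1 div0n mod0n.
rewrite numeral_cons sumdigits_step // mulnDr mulnA -expnSr -mono_comp // IH //; last first.
  by move=> j /ltnW; exact: hT.
have [c ->] := dvdnP (sD _ dD).
have -> : mono (b ^ T * (c * digit_gcd D)) (c * digit_gcd D) e = iter c (W U V D T) e.
  by rewrite /W iter_mono // mulnA (mulnC _ c) -mulnA (mulnC (b ^ T)%N).
by elim: c => //= c ->; exact: hT.
Qed.

(** By [mono_fixed] only the [T] lowest digits act on [e], so the mean over each complete block of
    length [b ^ T] is exactly [A T e]. After subtracting this limit only boundary terms remain. *)
Lemma avg_eventually_fixed e : (forall d, d \in D -> (digit_gcd D %| d)%N) ->
  eventually_fixed U V D e -> exists l, converges (avg e) l.
Proof.
move=> sD [T hT]; exists (A T e) => eps e0.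
set B := (b ^ T)%N; have B0 : (0 < B)%N by rewrite expn_gt0 b0.
pose f j := mono j (sumdigits b j) e - A T e.
have fK j : nr (f j) <= 2 * nr e.
  apply: le_trans (nrB _ _) _; rewrite mono_nr.
  have := A_contract ipP Ui Vi D0 T e; lra.
have K0 : 0 <= 2 * B%:R * (2 * nr e) by rewrite !mulr_ge0 ?nr_ge0.
have [N0 hN0] := small_quotient K0 e0; exists N0.+1 => N NN.
have N1 : (0 < N)%N := leq_trans (ltn0Sn _) NN.
have -> : avg e N - A T e = (N%:R : R[i])^-1 *: \sum_(0 <= j < k N | C j) f j.
  rewrite avgE /f sumrB scalerBr; congr (_ - _).
  have -> : \sum_(0 <= j < k N | C j) A T e = N%:R *: A T e.
    rewrite -{2}(count_below N) natr_sum scaler_suml; apply: eq_bigr => j _.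
    by rewrite scale1r.
  by rewrite scalerA mulVf ?scale1r // pnatr_eq0 -lt0n.
rewrite nrZV; apply: le_lt_trans (hN0 N (ltnW NN)).
rewrite ler_wpM2l ?invr_ge0 //; apply: le_trans (nr_boundary_blocks _ B0 fK) _.
rewrite (_ : \sum_(B <= j < _ | C j) f j = 0) ?nr0 ?addr0 //.
rewrite /f sumrB -{1}[B]muln1 mono_sum_blocks //; apply/eqP; rewrite subr_eq0; apply/eqP.
set Q := (k N %/ B)%N.
have -> : \sum_(B <= j < B * Q | C j) A T e =
    ((\sum_(B * 1 <= j < B * Q | C j) 1)%N%:R : R[i]) *: A T e.
  rewrite muln1 natr_sum scaler_suml; apply: eq_bigr => j _; by rewrite scale1r.
rewrite /B (count_blocks b1) // natrM -scalerA; congr (_ *: _).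
rewrite natr_sum scaler_suml; apply: eq_bigr => q /asboolP Cq; rewrite scale1r.
have bA := bicommutant_A Ui Vi D T.
rewrite -(bicommutant_comm Ui Vi UV bA (bicommutant_mono Ui Vi _ _)).
by rewrite (mono_fixed sD hT Cq).
Qed.

(** The averages are contractions uniformly in [N], so convergence passes to the closure. *)
Lemma avg_adherent (P : H -> Prop) p : (forall e, P e -> exists l, converges (avg e) l) ->
  adherent P p -> exists l, converges (avg p) l.
Proof.
move=> hP ap; apply: converges_Cauchy => eps e0.
have e4 : 0 < eps / 4 by rewrite divr_gt0.
have [e /hP[l hl] pe] := ap _ e4; have [N hN] := hl _ e4; exists N => n m Nn Nm.
have h1 := avg_contract (p - e) n; have h2 := avg_contract (p - e) m.
have -> : avg p n - avg p m =
    avg (p - e) n - avg (p - e) m + ((avg e n - l) - (avg e m - l)).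
  rewrite !avgB; set x1 := avg p n; set x2 := avg p m; set x3 := avg e n; set x4 := avg e m.
  have -> : x3 - l - (x4 - l) = x3 - x4 by rewrite opprB addrA subrK.
  rewrite opprB (addrC x4) [x1 - x3 + _]addrACA -[RHS]addrA [- x3 + x4 + _]addrACA.
  by rewrite addNr subrr add0r addr0.
have := nrD (avg (p - e) n - avg (p - e) m) ((avg e n - l) - (avg e m - l)).
have := nrB (avg (p - e) n) (avg (p - e) m); have := nrB (avg e n - l) (avg e m - l).
have := hN n Nn; have := hN m Nm; lra.
Qed.

Lemma avg_converges x : (forall d, d \in D -> (digit_gcd D %| d)%N) ->
  exists l, converges (avg x) l.
Proof.
move=> sD; have Wl j := (W_isometry Ui Vi D j).1.
have [|u v [T hT] [T' hT']|a u [T hT]|p pP hp] :=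
    @projection _ _ _ ipP (eventually_fixed U V D) x.
- by exists 0%N => j _; exact: lin0.
- exists (maxn T T') => j; rewrite geq_max => /andP[h h'].
  by rewrite (linD (Wl j)) hT // hT'.
- by exists T => j h; rewrite (linZ (Wl j)) hT.
have [l hl] := avg_adherent (fun e => avg_eventually_fixed sD) pP.
have h0 := avg_null (null_of_orth_fixed ipP Ui Vi UV b1 D0 hp).
exists (0 + l) => eps e0; have [N hN] := convergesD h0 hl e0; exists N => n Nn.
by have := hN n Nn; rewrite avgB subrK.
Qed.

End Averages.

(** * Good eigenvectors *)

Section RootsOfUnity.
Context {R : realType}.

Lemma eeD (x y : R) : ee (x + y) = ee x * ee y.
Proof.
apply/eqP; rewrite eq_complex /ee /= mulrDr cosD sinD eqxx /=.
by apply/eqP; ring.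
Qed.

Lemma ee0 : ee (0 : R) = 1.
Proof. by rewrite /ee mulr0 cos0 sin0. Qed.

Lemma eeX (x : R) k : ee x ^+ k = ee (k%:R * x).
Proof.
elim: k => [|k IH]; first by rewrite expr0 mul0r ee0.
by rewrite exprS IH -eeD -natr1 mulrDl mul1r addrC.
Qed.

(** The real part is [cos^2 - sin^2] at [pi x], where the sine is positive. *)
Lemma ee_neq1 (x : R) : 0 < x < 1 -> ee x != 1.
Proof.
move=> /andP[x0 x1]; apply/eqP => /eqP; rewrite eq_complex /= => /andP[/eqP h _].
have p0 : 0 < sin (pi * x).
  apply: sin_gt0_pi; rewrite mulr_gt0 ?pi_gt0 //=.
  by rewrite -[ltRHS]mulr1 ltr_pM2l ?pi_gt0.
have e : 2 * pi * x = pi * x + pi * x by ring.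
move: h; rewrite e cosD => h.
by have := cos2Dsin2 (pi * x); nra.
Qed.

Context (n : nat) (n0 : (0 < n)%N).

Definition root1 : R[i] := ee (n%:R^-1 : R).

Lemma root1_exp k : root1 ^+ k = ee (k%:R / n%:R : R).
Proof. exact: eeX. Qed.

Lemma root1_neq1 k : (0 < k < n)%N -> root1 ^+ k != 1.
Proof.
move=> /andP[k0 kn]; rewrite root1_exp ee_neq1 // divr_gt0 ?ltr0n //=.
by rewrite ltr_pdivrMr ?ltr0n // mul1r ltr_nat.
Qed.

Lemma root1_exp_order : root1 ^+ n = 1.
Proof.
rewrite root1_exp mulfV ?pnatr_eq0 -?lt0n //; apply/eqP; rewrite eq_complex /= mulr1.
by rewrite mulr_natl cos2pi sin2pi !eqxx.
Qed.

Lemma root1_dvd k : root1 ^+ k = 1 -> (n %| k)%N.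
Proof.
rewrite {1}(divn_eq k n) exprD mulnC exprM root1_exp_order expr1n mul1r => h.
rewrite /dvdn; apply: contraT => k0.
by have := @root1_neq1 (k %% n); rewrite lt0n k0 ltn_mod n0 h eqxx => /(_ isT).
Qed.

Lemma root1_neq0 : root1 != 0.
Proof.
apply/eqP => h; have := root1_exp_order; rewrite h expr0n eqn0Ngt n0 => /eqP.
by rewrite eq_sym oner_eq0.
Qed.

(** Orthogonality of characters of the cyclic group of order [n]: for [k != 0] the geometric sum is
    killed by the nonzero factor [z - 1]. *)
Lemma root1_sum k : (k < n)%N ->
  \sum_(i < n) root1^-1 ^+ (i * k) = if k == 0%N then n%:R else 0.
Proof.
move=> kn; case: eqVneq => [->|k0].
  under eq_bigr do rewrite muln0 expr0.
  by rewrite sumr_const card_ord.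
under eq_bigr do rewrite mulnC exprM.
set z := root1^-1 ^+ k.
have z1 : z - 1 != 0.
  rewrite subr_eq0 /z exprVn; apply: contra (@root1_neq1 k _); last by rewrite lt0n k0.
  by rewrite invr_eq1.
apply: (mulfI z1); rewrite mulr0 -subrX1 /z -exprM mulnC exprM exprVn root1_exp_order.
by rewrite invr1 expr1n subrr.
Qed.

End RootsOfUnity.

(** * Decomposition of periodic vectors into eigenvectors *)

Section FiniteFourier.
Context {R : realType} {H : completeNormedModType R[i]}.
Context (n : nat) (n0 : (0 < n)%N).
Local Notation w := (@root1 R n).
Implicit Types (f g : H -> H) (x : H).

(** For linear [f] with [f^n x = x] this is the component of [x] with eigenvalue [w^i]. *)
Definition fourier f i x : H :=
  (n%:R : R[i])^-1 *: \sum_(k < n) (w^-1 ^+ (i * k)) *: iter k f x.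

Lemma fourier_sum f x : x = \sum_(i < n) fourier f i x.
Proof.
rewrite -scaler_sumr exchange_big /=.
transitivity ((n%:R : R[i])^-1 *: \sum_(k < n) (if k == 0%N :> nat then n%:R else 0 : R[i]) *: iter k f x).
  case: n n0 => // m _; rewrite big_ord_recl /= big1 => [|k _]; last by rewrite scale0r.
  by rewrite addr0 scalerA mulVf ?scale1r // pnatr_eq0.
congr (_ *: _); apply: eq_bigr => k _; rewrite -scaler_suml; congr (_ *: _).
by rewrite root1_sum.
Qed.

Lemma fourier_comm f g i x : lin g -> (forall y, f (g y) = g (f y)) ->
  g (fourier f i x) = fourier f i (g x).
Proof.
move=> gl fg; rewrite /fourier (linZ gl) (linS gl); congr (_ *: _).
by apply: eq_bigr => k _; rewrite (linZ gl) iter_comm.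
Qed.

(** Applying [f] shifts the summation index, and [g n = g 0] closes the cycle. *)
Lemma fourier_eigen f i x : lin f -> iter n f x = x ->
  f (fourier f i x) = w ^+ i *: fourier f i x.
Proof.
move=> fl fn; rewrite /fourier (linZ fl) (linS fl) scalerA mulrC -scalerA; congr (_ *: _).
pose g k := (w^-1 ^+ (i * k)) *: iter k f x.
have w0 := @root1_neq0 R _ n0.
have gn : g n = g 0%N.
  rewrite /g fn muln0 mulnC exprM exprVn root1_exp_order //.
  by rewrite invr1 expr1n expr0.
have shift : \sum_(k < n) g k.+1 = \sum_(k < n) g k.
  have e1 : \sum_(k < n.+1) g k = g 0%N + \sum_(k < n) g k.+1 by rewrite big_ord_recl.
  have e2 : \sum_(k < n.+1) g k = \sum_(k < n) g k + g n by rewrite big_ord_recr.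
  by apply: (addrI (g 0%N)); rewrite -e1 e2 gn addrC.
rewrite -[X in _ *: X]/(\sum_(k < n) g k) -shift scaler_sumr; apply: eq_bigr => k _.
by rewrite (linZ fl) /g scalerA mulnS exprD mulrA -exprMn mulfV // expr1n mul1r.
Qed.

Lemma iter_eigen f (c : R[i]) k x : lin f -> f x = c *: x -> iter k f x = c ^+ k *: x.
Proof.
move=> fl h; elim: k => [|k IH]; first by rewrite expr0 scale1r.
by rewrite /= IH (linZ fl) h scalerA exprSr.
Qed.

End FiniteFourier.

(** * Eventually fixed vectors and good eigenvectors *)

Section GoodEigenvectors.
Context {R : realType} {H : completeNormedModType R[i]}.
Context (ip : H -> H -> R[i]) (ipP : is_inner_product ip).
Context (U V : H -> H) (Ui : lin_isometry ip U) (Vi : lin_isometry ip V).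
Context (UV : forall x, U (V x) = V (U x)).
Context (b : nat) (b1 : (1 < b)%N) (D : {set 'I_b}) (s0 : (0 < digit_gcd D)%N).
Local Notation s := (digit_gcd D).

(** With [alpha = i/n] and [beta = j/n] the hypotheses say [s b^T alpha + s beta = c] and
    [(b - 1) s beta = a]. Hence [s beta = a / (b - 1)] and [s alpha = (c - a / (b - 1)) / b^T]. *)
Lemma good_exponents (n i j T c a : nat) :
  (0 < n)%N -> (i * (s * b ^ T) + j * s = c * n)%N -> (j * (b.-1 * s) = a * n)%N ->
  exists (a r t m1 m2 : int),
    s%:R * (i%:R / n%:R) = a%:~R / (b%:R - 1) + r%:~R / (b%:R ^ t) + m1%:~R :> R /\
    s%:R * (j%:R / n%:R) = - (a%:~R / (b%:R - 1)) + m2%:~R :> R.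
Proof.
move=> n0 hc ha.
have N0 : n%:R != 0 :> R by rewrite pnatr_eq0 -lt0n.
have B0 : b%:R != 0 :> R by rewrite pnatr_eq0 -lt0n ltnW.
have X0 : b%:R ^+ T != 0 :> R by rewrite expf_neq0.
have B1 : b%:R - 1 != 0 :> R by rewrite subr_eq0 -[1]/(1%:R) eqr_nat gtn_eqF.
have {}hc : i%:R * (s%:R * b%:R ^+ T) + j%:R * s%:R = c%:R * n%:R :> R.
  by rewrite -natrX -!natrM -natrD hc.
have {}ha : j%:R * ((b%:R - 1) * s%:R) = a%:R * n%:R :> R.
  by rewrite -[in RHS]natrM -ha !natrM -subn1 natrB // ltnW.
(* With [g = (b^T - 1) / (b - 1)], the value of [s alpha] equals [- a / (b - 1) + (c + a g) / b^T];
   this gives the witnesses [- a], [c + a g] and [T]. *)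
pose g := (\sum_(l < T) b ^ l)%N.
have hg : (b%:R - 1) * g%:R = b%:R ^+ T - 1 :> R.
  by rewrite subrX1 /g natr_sum; congr (_ * _); apply: eq_bigr => l _; rewrite natrX.
have ej : s%:R * (j%:R / n%:R) = a%:R / (b%:R - 1) :> R.
  have -> : s%:R * (j%:R / n%:R) = j%:R * ((b%:R - 1) * s%:R) / (n%:R * (b%:R - 1)) :> R.
    by field; rewrite N0 B1.
  by rewrite ha; field; rewrite N0 B1.
exists (- (a%:Z)), ((c + a * g)%N : int), (T : int), 0, 0.
split; last first.
  by rewrite ej mulrNz mulNr opprK addr0.
rewrite addr0 mulrNz -exprnP -!pmulrn natrD natrM.
have eg : g%:R = (b%:R ^+ T - 1) / (b%:R - 1) :> R by rewrite -hg mulrAC mulfV ?mul1r.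
have -> : s%:R * (i%:R / n%:R) = (i%:R * (s%:R * b%:R ^+ T)) / n%:R / b%:R ^+ T :> R.
  by field; rewrite N0 X0.
have -> : i%:R * (s%:R * b%:R ^+ T) = c%:R * n%:R - j%:R * s%:R :> R by rewrite -hc addrK.
have -> : (c%:R * n%:R - j%:R * s%:R) / n%:R = c%:R - s%:R * (j%:R / n%:R) :> R.
  by field.
by rewrite ej eg; field; rewrite X0 B1.
Qed.

(** Invariance under [W T] and [Q] makes [e] periodic under [U] and [V], so two finite Fourier
    transforms write it as a sum of joint eigenvectors. These inherit both invariances, which make
    the nonzero ones good. *)
Lemma orth_eventually_fixed x e :
  (forall y, good_eigvec b s U V y -> ip x y = 0) -> eventually_fixed U V D e ->
  rip ip x e = 0.
Proof.
move=> hx eS; have Qe := eventually_fixed_Q ipP Ui Vi UV b1 eS.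
have [T hT] := eS; have We := hT T (leqnn T).
pose n := (b ^ T * (b.-1 * s))%N.
have n0 : (0 < n)%N by rewrite !muln_gt0 expn_gt0 ltnW //= s0 -subn1 subn_gt0 b1.
have mul_fix f m k y : iter k f y = y -> iter (m * k) f y = y.
  by move=> h; elim: m => // m IH; rewrite mulSn iterD IH.
have nV : iter n V e = e by apply: mul_fix; exact: Qe.
(* [W_T^(b - 1)] equals [U^n Q], and both [W_T] and [Q] fix [e]. *)
have nU : iter n U e = e.
  have h : mono U V (b.-1 * (s * b ^ T)) (b.-1 * s) e = e.
    by rewrite -iter_mono //; elim: b.-1 => //= m ->; exact: We.
  have QV : iter (b.-1 * s) V e = e := Qe.
  by rewrite /mono QV mulnA mulnC in h.
have Ul := Ui.1; have Vl := Vi.1.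
rewrite [e](fourier_sum n0 U e) (ripC ipP) rip_suml // big1 // => i _.
rewrite [fourier n U i e](fourier_sum n0 V) rip_suml // big1 // => j _.
set y := fourier n V j _.
have [->|y0] := eqVneq y 0; first exact: rip0l.
rewrite (ripC ipP) /rip hx //; split=> //.
have scl (c : R[i]) : lin (fun z : H => c *: z).
  by move=> a u v; rewrite scalerDr !scalerA mulrC.
have yU : U y = root1 n ^+ i *: y.
  rewrite /y (fourier_comm _ _ _ Ul) // fourier_eigen //.
  by rewrite -(fourier_comm _ _ _ (scl _)) // => z; rewrite (linZ Vl).
have yV : V y = root1 n ^+ j *: y.
  apply: fourier_eigen => //; rewrite (fourier_comm _ _ _ (lin_iter Vl n)) ?nV // => z.
  by rewrite (iter_comm (f := V)).
have mono_fix p q : mono U V p q e = e -> mono U V p q y = y.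
  have [gl gc] := bicommutant_mono Ui Vi p q.
  by move=> ge; rewrite /y !(fourier_comm _ _ _ gl) ?ge // => z; rewrite gc.
have yW : mono U V (s * b ^ T) s y = y by exact: mono_fix.
have yQ : mono U V 0 (b.-1 * s) y = y by exact: mono_fix.
have mono_y p q : mono U V p q y = root1 n ^+ (i * p + j * q) *: y.
  rewrite /mono (iter_eigen q Vl yV) (linZ (lin_iter Ul p)) (iter_eigen p Ul yU).
  by rewrite scalerA -!exprM -exprD addnC.
have root_y p q : mono U V p q y = y -> (n %| i * p + j * q)%N.
  rewrite mono_y => h; apply: (@root1_dvd R) => //.
  apply/eqP; rewrite -subr_eq0; have /eqP := h.
  by rewrite -subr_eq0 -{2}[y]scale1r -scalerBl scaler_eq0 (negPf y0) orbF.
(* Invariance of [y != 0] under [W T] and [Q] becomes divisibility by [n] of the exponents of the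
   primitive root. *)
have /dvdnP[c hc] := root_y _ _ yW; have /dvdnP[a] := root_y _ _ yQ.
rewrite muln0 add0n => ha.
exists (i%:R / n%:R), (j%:R / n%:R); rewrite -!root1_exp; split => //.
exact: good_exponents hc ha.
Qed.

End GoodEigenvectors.

(** * Existence and identification of the limit *)

Theorem mainTheorem12 (R : realType) (H : completeNormedModType R[i])
  (ip : H -> H -> R[i]) (b : nat) (D : {set 'I_b}) (k : nat -> nat)
  (U V : H -> H) :
  is_inner_product ip ->
  (3 <= b)%N -> (2 <= #|D|)%N -> (#|D| < b)%N ->
  (forall d, d \in D -> (digit_gcd D %| d)%N) ->
  (forall n m, (n < m)%N -> (k n < k m)%N) ->
  range k = digit_set D ->
  unitary ip U -> unitary ip V -> (forall x, U (V x) = V (U x)) ->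
  forall x : H,
    (exists l : H, erg_avg b k U V x @ \oo --> l) /\
    (forall p : H, closed_span (good_eigvec b (digit_gcd D) U V) p ->
       (forall z, closed_span (good_eigvec b (digit_gcd D) U V) z -> ip (x - p) z = 0) ->
       exists l : H, erg_avg b k U V x @ \oo --> l /\ erg_avg b k U V p @ \oo --> l) /\
    ((forall y, good_eigvec b (digit_gcd D) U V y -> ip x y = 0) ->
       erg_avg b k U V x @ \oo --> 0).
Proof.
move=> ipP b3 D2 _ sD kmono kC [Ul _ Uip] [Vl _ Vip] UV x.
have Ui : lin_isometry ip U by split=> // y z; rewrite /rip Uip.
have Vi : lin_isometry ip V by split=> // y z; rewrite /rip Vip.
have b1 : (1 < b)%N by exact: ltnW.
have D0 : (0 < size (digits D))%N by rewrite size_map -cardE ltnW.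
have s0 : (0 < digit_gcd D)%N.
  (* If the gcd were [0], divisibility would force every digit to be [0], against [D] having two
     elements. *)
  rewrite lt0n; apply/eqP => s0; have [d [d' [dD d'D]]] := card_gt1P D2.
  apply: contra_neqP => _; apply: val_inj.
  have := sD _ dD; have := sD _ d'D.
  by rewrite s0 !dvd0n => /eqP h' /eqP h; exact: etrans h (esym h').
have orth y : (forall z, good_eigvec b (digit_gcd D) U V z -> ip y z = 0) ->
    converges (erg_avg b k U V y) 0.
  move=> hy; apply: (avg_null ipP Ui Vi UV b1 D0 kmono kC).
  apply: (null_of_orth_fixed ipP Ui Vi UV b1 D0) => e.
  exact: orth_eventually_fixed.
split; [|split=> [p _ hp|hx]]; last by apply/convergesP; exact: orth.
  have [l hl] := avg_converges ipP Ui Vi UV b1 D0 kmono kC x sD.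
  by exists l; apply/convergesP.
have [l hl] := avg_converges ipP Ui Vi UV b1 D0 kmono kC p sD.
exists l; split; apply/convergesP => //.
(* Each good eigenvector is a one-term combination in the span, so [x - p] is orthogonal to it and
   its averages vanish in the limit. *)
have h0 : converges (erg_avg b k U V (x - p)) 0.
  apply: orth => z hz; apply: hp; apply: subset_closure.
  by exists 1%N, (fun=> 1), (fun=> z); rewrite big_ord1 scale1r.
rewrite -[l]add0r => eps e0; have [N hN] := convergesD h0 hl e0; exists N => n Nn.
by have := hN n Nn; rewrite (avgB Ui Vi kmono kC) subrK.
Qed.
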